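(* A classical (respectively, intuitionistic) tensor sequent that is derivable in $\mathbf{TTL}$ (respectively, in $\mathbf{ITTL}$) is valid in every tensor term model of the given tensor language.
   Context: Classical tensor language. Fix an infinite set $\mathit{Ind}$ of indices and a set $\mathit{Lit}_+$ of positive literals, each $p\in\mathit{Lit}_+$ having a valency $v(p)\in\mathbb N^2$. Put $\mathit{Lit}_-=\{\overline p\mid p\in\mathit{Lit}_+\}$, $\overline{\overline p}=p$, $\mathit{Lit}=\mathit{Lit}_+\cup\mathit{Lit}_-$, $\mathit{Prop}=\mathit{Lit}\cup\{\mathbf 1,\bot\}$, with $v(\overline p)=(m,n)$ if $v(p)=(n,m)$, $v(\mathbf 1)=v(\bot)=(1,1)$, $\overline{\mathbf 1}=\bot$, $\overline{\bot}=\mathbf 1$. Atomic formulas are the expressions $p^{i_1\ldots i_m}_{j_1\ldots j_n}$ with $p\in\mathit{Prop}$, $v(p)=(m,n)$ and pairwise distinct indices. (Classical tensor) formulas are built from atomic ones by the binary connectives $\otimes,\wp$, subject to the condition that any index has at most one upper and at most one lower occurrence in the formula. Duality: $\overline{p^{i_1\ldots i_m}_{j_1\ldots j_n}}=\overline p^{\,j_n\ldots j_1}_{\,i_m\ldots i_1}$, $\overline{A\otimes B}=\overline B\wp\overline A$, $\overline{A\wp B}=\overline B\otimes\overline A$. An index of a formula is free if it occurs exactly once, otherwise bound. $FI^\bullet(A)$, $FI_\bullet(A)$ are the sets of free upper, respectively lower, indices of $A$, and $FI(A)=(FI^\bullet(A),FI_\bullet(A))$. $A^{[i/j]}$ (respectively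 $A_{[i/j]}$) is $A$ with $i$ substituted for the free upper (respectively lower) occurrence of $j$; it is implicitly assumed that $i$ does not occur in $A$. A (classical tensor) context is a finite unordered multiset $\Gamma$ of formulas such that $FI^\bullet(A)\cap FI^\bullet(B)=FI_\bullet(A)\cap FI_\bullet(B)=\emptyset$ for any two distinct occurrences $A,B$ in $\Gamma$; $FI^\bullet(\Gamma)$, $FI_\bullet(\Gamma)$ are the unions over formulas of $\Gamma$. A (classical tensor) sequent is $\vdash\Gamma$ where $\Gamma$ is a context with $FI^\bullet(\Gamma)=FI_\bullet(\Gamma)$. Rules of $\mathbf{TTL}$ (all expressions are required to be well-formed sequents): (Id) $\vdash\overline A,A$ for $A$ atomic; (Cut) from $\vdash\Gamma,A$ and $\vdash\overline A,\Delta$ infer $\vdash\Gamma,\Delta$; ($\otimes$) from $\vdash\Gamma,A$ and $\vdash B,\Delta$ infer $\vdash\Gamma,A\otimes B,\Delta$; ($\wp$) from $\vdash\Gamma,A,B$ infer $\vdash\Gamma,A\wp B$; ($\bot^\to$) from $\vdash\Gamma,A$ with $j\in FI^\bullet(A)$ infer $\vdash\Gamma,\bot^j_i,A^{[i/j]}$; ($\bot_\leftarrow$) from $\vdash\Gamma,A,\bot^j_i$ with $j\in FI_\bullet(A)$ infer $\vdash\Gamma,A_{[i/j]}$; in the last two rules $i\notin FI^\bullet(A)\cup FI_\bullet(A)$. Intuitionistic tensor language (over the same literals $\mathit{Lit}_+$). Formulas are built from atomic formulas $p^{i_1\ldots i_m}_{j_1\ldots j_n}$, $p\in\mathit{Lit}_+\cup\{\mathbf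 1\}$, $v(p)=(m,n)$ (indices pairwise distinct), by $\otimes$ and $\multimap$. Polarity of index occurrences: in atomic formulas upper indices have upper polarity and lower indices lower polarity; $\otimes$ preserves polarities; in $A\multimap B$ polarities of occurrences in $B$ are preserved and those in $A$ are reversed. A formula must have at most one upper polarity and at most one lower polarity occurrence of any index. An index of an intuitionistic formula is free if it occurs exactly once, otherwise bound; $FI^\bullet(A)$, $FI_\bullet(A)$ are the sets of free indices of $A$ whose occurrence has upper, respectively lower, polarity; $A^{[i/j]}$ (respectively $A_{[i/j]}$) is $A$ with $i$ substituted for the free upper polarity (respectively lower polarity) occurrence of $j$, where it is implicitly assumed that $i$ does not occur in $A$. Intuitionistic contexts are finite multisets $\Gamma$ of intuitionistic formulas such that $FI^\bullet(A)\cap FI^\bullet(B)=FI_\bullet(A)\cap FI_\bullet(B)=\emptyset$ for any two distinct occurrences $A,B$ in $\Gamma$; $FI^\bullet(\Gamma)$, $FI_\bullet(\Gamma)$ are the unions over formulas of $\Gamma$. An intuitionistic sequent is $\Gamma\vdash A$ with $FI^\bullet(\Gamma)\cap FI_\bullet(A)=FI_\bullet(\Gamma)\cap FI^\bullet(A)=\emptyset$ and $FI^\bullet(\Gamma)\cup FI_\bullet(A)=FI_\bullet(\Gamma)\cup FI^\bullet(A)$. Intuitionistic formulas are identified with classical ones by $A\multimap B=\overline A\wp B$, and $\Gamma\vdash B$ with $\vdash\overline\Gamma,B$. Rules of $\mathbf{ITTL}$ (all expressions are required to be well-formed sequents): (Id) $A\vdash A$ for $A$ atomic; (Cut) from $\Gamma\vdash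 A$ and $A,\Delta\vdash B$ infer $\Gamma,\Delta\vdash B$; (L$\multimap$) from $\Gamma\vdash A$ and $B,\Delta\vdash C$ infer $\Gamma,A\multimap B,\Delta\vdash C$; (R$\multimap$) from $\Gamma,A\vdash B$ infer $\Gamma\vdash A\multimap B$; (L$\otimes$) from $\Gamma,A,B\vdash C$ infer $\Gamma,A\otimes B\vdash C$; (R$\otimes$) from $\Gamma\vdash A$ and $\Delta\vdash B$ infer $\Gamma,\Delta\vdash A\otimes B$; (L$1_\to$) from $\Gamma,A\vdash B$, $j\in FI_\bullet(A)$, infer $\Gamma,A_{[i/j]},\mathbf 1^i_j\vdash B$; (R$1^\to$) from $\Gamma\vdash A$, $j\in FI^\bullet(A)$, infer $\mathbf 1^i_j,\Gamma\vdash A^{[i/j]}$; (L$1^\leftarrow$) from $\Gamma,\mathbf 1^i_j,A\vdash B$, $j\in FI^\bullet(A)$, infer $\Gamma,A^{[i/j]}\vdash B$; (R$1_\leftarrow$) from $\Gamma,\mathbf 1^i_j\vdash A$, $j\in FI_\bullet(A)$, infer $\Gamma\vdash A_{[i/j]}$; in the last four rules $i\notin FI^\bullet(A)\cup FI_\bullet(A)$. Tensor terms. Let $T$ be an alphabet of terminal symbols, $\epsilon$ the empty word. Pseudo-terms over $T$ are the elements of the free commutative monoid (written multiplicatively, unit $1$) generated by symbols $[w]^j_i$ ($i,j\in\mathit{Ind}$, $w\in T^*$) and $[w]$ ($w\in T^*$). A pseudo-term is well-formed if every index has at most one lower and at most one upper occurrence in it. Tensor terms are well-formed pseudo-terms modulo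 the congruence generated by $[u]^i_j\cdot[v]^j_k\equiv[uv]^i_k$, $[w]^i_i\equiv[w]$, $[a_1\ldots a_n]\equiv[a_na_1\ldots a_{n-1}]$ ($a_1,\ldots,a_n\in T$). An index is free if it occurs once, bound if twice; the sets $FI^\bullet(t)$, $FI_\bullet(t)$ of free upper, lower indices of a term $t$ are well-defined, and $FI(t)=(FI^\bullet(t),FI_\bullet(t))$ is the boundary of $t$. The product $ts$ is defined when $FI^\bullet(t)\cap FI^\bullet(s)=FI_\bullet(t)\cap FI_\bullet(s)=\emptyset$ (bound indices being renamed to avoid clashes). $\delta^j_i=[\epsilon]^j_i$, $i\ne j$. $t^{[i/j]}$ (respectively $t_{[i/j]}$) is $t$ with the free upper (respectively lower) index $j$ replaced by a fresh index $i$. In iterated products $t_{(1)}\cdots t_{(n)}$ it is assumed that the sets $FI^\bullet(t_{(k)})$ are pairwise disjoint and the sets $FI_\bullet(t_{(k)})$ are pairwise disjoint. Semantic types. A pretype $A$ over $T$ is a set of tensor terms having a common boundary $FI(A)=(FI^\bullet(A),FI_\bullet(A))$, a pair of disjoint finite index sets (for empty $A$ the boundary is part of the data). A semantic type system $(T,{\bot\!\!\!\bot})$ consists of $T$ and a pretype ${\bot\!\!\!\bot}$ (the dualizing type; here ${\bot\!\!\!\bot}$ is just a letter) with $FI^\bullet({\bot\!\!\!\bot})=FI_\bullet({\bot\!\!\!\bot})=\emptyset$. The dual of $A$ is $\overline A=\{s\mid \forall t\in A\ ts\in{\bot\!\!\!\bot}\}$, with boundary $(FI_\bullet(A),FI^\bullet(A))$.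 A pretype $A$ is a (semantic) type if $A=\overline{\overline A}$. For types: $A\multimap B=\{t\mid\forall s\in A\ ts\in B\}$ if $FI^\bullet(A)\cap FI_\bullet(B)=FI_\bullet(A)\cap FI^\bullet(B)=\emptyset$; and if $FI^\bullet(A)\cap FI^\bullet(B)=FI_\bullet(A)\cap FI_\bullet(B)=\emptyset$ then $A\cdot B=\{ts\mid t\in A,s\in B\}$, $A\otimes B=\overline{\overline{A\cdot B}}$, $A\wp B=\overline{\overline A\cdot\overline B}$. For indices $x\ne y$: $\bot^x_y=\overline{\{\delta^y_x\}}$, $\mathbf 1^x_y=\overline{\overline{\{\delta^x_y\}}}$. For $x\in FI^\bullet(A)$, $y\notin FI^\bullet(A)\cup FI_\bullet(A)$: $A^{[y/x]}=\{t^{[y/x]}\mid t\in A\}$; similarly $A_{[y/x]}$ for $x\in FI_\bullet(A)$. Iterated cotensor products $X_1\wp\cdots\wp X_n$ are taken for types with pairwise disjoint $FI^\bullet(X_k)$ and pairwise disjoint $FI_\bullet(X_k)$. Models. A tensor term model of the (classical or intuitionistic) language generated by $\mathit{Lit}_+$ consists of a semantic type system $(T,{\bot\!\!\!\bot})$ and a valuation $\|\cdot\|$ mapping every atomic formula $A=p^{i_1\ldots i_k}_{j_1\ldots j_l}$, $p\in\mathit{Lit}_+$, to a semantic type $\|A\|$ with boundary $(\{i_1,\ldots,i_k\},\{j_1,\ldots,j_l\})$ such that $\|A^{[i/j]}\|=\|A\|^{[i/j]}$ for $j\in FI^\bullet(A)$, $i$ fresh, and $\|A_{[i/j]}\|=\|A\|_{[i/j]}$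 for $j\in FI_\bullet(A)$, $i$ fresh. It extends to all formulas by $\|\mathbf 1^i_j\|=\mathbf 1^i_j$, $\|\bot^i_j\|=\bot^i_j$, $\|\overline A\|=\overline{\|A\|}$, $\|A\otimes B\|=\|A\|\otimes\|B\|$, $\|A\wp B\|=\|A\|\wp\|B\|$, $\|A\multimap B\|=\|A\|\multimap\|B\|$. A sequent $A_{(1)},\ldots,A_{(n)}\vdash A$ (classically $\vdash\overline{A_{(1)}},\ldots,\overline{A_{(n)}},A$) is valid in the model if one of the following equivalent conditions holds: (i) whenever $t_{(k)}\in\|A_{(k)}\|$ for $k=1,\ldots,n$, then $t_{(1)}\cdots t_{(n)}\in\|A\|$ (for $n=0$: $1\in\|A\|$); (ii) $1\in\overline{\|A_{(1)}\|}\wp\cdots\wp\overline{\|A_{(n)}\|}\wp\|A\|$. *)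

(* Defs.v *)
From HB Require Import structures.
From mathcomp Require Import all_boot finmap generic_quotient.
From mathcomp Require Import boolp classical_sets cardinality zify.
From Stdlib Require Import Permutation.

Set Implicit Arguments.
Unset Strict Implicit.
Unset Printing Implicit Defensive.

Local Open Scope quotient_scope.
Local Open Scope classical_set_scope.

Section Indices.
Variable Ind : choiceType.

(* [once up lo]: the indices listed in [up] that occur exactly once in [up] and
   [lo] together, that is, the free indices among [up]. *)
Definition once (up lo : seq Ind) : {fset Ind} :=
  [fset x in up | count_mem x (up ++ lo) == 1]%fset.

Definition repl (i j x : Ind) : Ind := if x == j then i else x.

Lemma in_once (up lo : seq Ind) x : uniq up ->
  (x \in once up lo) = (x \in up) && (x \notin lo).
Proof.
move=> Uup; rewrite !inE /= count_cat (count_uniq_mem _ Uup).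
by case: (x \in up) => //=; rewrite eqSS -leqn0 leqNgt -has_count has_pred1.
Qed.

End Indices.

Section Terms.
Variables (Ind T : choiceType).

(* [Edge j i w] is the symbol [w]^j_i (upper index j, lower index i) and
   [Loop w] the symbol [w]. *)
Inductive symb := Edge of Ind & Ind & seq T | Loop of seq T.

Definition symb_code (g : symb) : (Ind * Ind * seq T) + seq T :=
  match g with Edge j i w => inl (j, i, w) | Loop w => inr w end.
Definition symb_decode (c : (Ind * Ind * seq T) + seq T) : symb :=
  match c with inl (j, i, w) => Edge j i w | inr w => Loop w end.
Lemma symb_codeK : cancel symb_code symb_decode.
Proof. by case. Qed.
HB.instance Definition _ := Choice.copy symb (can_type symb_codeK).

(* Commutativity of the product of pseudo-terms is part of [tcong] below. *)
Definition pterm := seq symb.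

Definition tup (t : pterm) : seq Ind :=
  flatten [seq (if g is Edge j _ _ then [:: j] else [::]) | g <- t].
Definition tlow (t : pterm) : seq Ind :=
  flatten [seq (if g is Edge _ i _ then [:: i] else [::]) | g <- t].

Definition pwf (t : pterm) : bool := uniq (tup t) && uniq (tlow t).

Inductive trule : pterm -> pterm -> Prop :=
| trule_glue u v i j k : trule [:: Edge i j u; Edge j k v] [:: Edge i k (u ++ v)]
| trule_close w i : trule [:: Edge i i w] [:: Loop w]
| trule_rot w a : trule [:: Loop (rcons w a)] [:: Loop (a :: w)].

(* The congruence lives on well-formed pseudo-terms only: if ill-formed
   intermediate pseudo-terms were allowed, [trule_glue] could be read backwards
   with a clashing index and would identify, for instance, [a]^i_k [b]^l_m with
   [a]^i_m [b]^l_k. *)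
Inductive tcong : pterm -> pterm -> Prop :=
| tcong_perm t s : pwf t -> pwf s -> perm_eq t s -> tcong t s
| tcong_rule t s : pwf t -> pwf s -> trule t s -> tcong t s
| tcong_mul t s r : pwf (t ++ r) -> pwf (s ++ r) -> tcong t s ->
    tcong (t ++ r) (s ++ r)
| tcong_sym t s : tcong t s -> tcong s t
| tcong_trans t s r : tcong t s -> tcong s r -> tcong t r.

Definition wterm := {t : pterm | pwf t}.

Definition teq (t s : wterm) : bool := `[< tcong (val t) (val s) >].

Lemma teq_refl : reflexive teq.
Proof. by case=> t wt; apply/asboolP/tcong_perm. Qed.
Lemma teq_sym : symmetric teq.
Proof. by move=> t s; apply/asboolP/asboolP => /tcong_sym. Qed.
Lemma teq_trans : transitive teq.
Proof.
by move=> s t r /asboolP ts /asboolP sr; apply/asboolP/(tcong_trans ts sr).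
Qed.
Canonical teq_equiv := EquivRel teq teq_refl teq_sym teq_trans.

Definition tterm := {eq_quot teq}.

(* Free indices do not depend on the representative. *)
Lemma tcong_free (t s : pterm) : tcong t s ->
  once (tup t) (tlow t) = once (tup s) (tlow s) /\
  once (tlow t) (tup t) = once (tlow s) (tup s).
Proof.
move=> ts.
have [[wt ws] bal] : (pwf t /\ pwf s) /\
    perm_eq (tup t ++ tlow s) (tup s ++ tlow t).
  elim: ts => {t s}.
  - move=> t s wt ws ts; split=> //; apply: perm_cat.
      by apply: perm_flatten; apply: perm_map.
    by apply: perm_flatten; apply: perm_map; rewrite perm_sym.
  - move=> t s wt ws ts; split=> //; apply/permP => a.
    by case: ts => [u v i j k|w i|w b] /=; lia.
  - move=> t s r wt ws _ [_ bal]; split=> //; apply/permP => a.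
    have /permP /(_ a) := bal.
    by rewrite /tup /tlow !map_cat !flatten_cat !count_cat; lia.
  - by move=> t s _ [[? ?] ?]; split=> //; rewrite perm_sym.
  - move=> t s r _ [[? ?] b1] _ [[? ?] b2]; split=> //; apply/permP => a.
    by move/permP/(_ a): b1; move/permP/(_ a): b2; rewrite !count_cat; lia.
have /andP[ut lt] := wt; have /andP[us ls] := ws.
have key x : (x \in tup t) + (x \in tlow s) = (x \in tup s) + (x \in tlow t).
  by move/permP/(_ (pred1 x)): bal; rewrite !count_cat !count_uniq_mem.
split; apply/fsetP => x; rewrite !in_once //; move: (key x);
  by do 4![case: (_ \in _)].
Qed.

Definition FIu (t : tterm) : {fset Ind} :=
  once (tup (val (repr t))) (tlow (val (repr t))).
Definition FIl (t : tterm) : {fset Ind} :=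
  once (tlow (val (repr t))) (tup (val (repr t))).

Definition wone : wterm := Sub ([::] : pterm) isT.
Definition tone : tterm := \pi_tterm wone.

Definition wdelta (j i : Ind) : wterm := Sub [:: Edge j i [::]] isT.
(* delta^j_i *)
Definition tdelta (j i : Ind) : tterm := \pi_tterm (wdelta j i).

(* [is_prod t s r]: the product ts is defined and equal to r. Choosing the
   representatives so that t' ++ s' is well-formed is the renaming of bound
   indices; it is possible exactly when t, s share no free upper index and no
   free lower index. *)
Definition is_prod (t s r : tterm) : Prop :=
  exists t' s' r' : wterm,
    [/\ \pi_tterm t' = t, \pi_tterm s' = s, \pi_tterm r' = r
      & val r' = val t' ++ val s'].

Fixpoint is_prods (ts : seq tterm) (r : tterm) : Prop :=
  if ts is t :: ts' then exists2 r', is_prods ts' r' & is_prod t r' r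
  else r = tone.

Definition prod_in (t s : tterm) (X : set tterm) : Prop :=
  exists2 r, is_prod t s r & X r.

(* [is_renu i j t r]: r is t^{[i/j]}, for j a free upper index of t and i fresh.
   The index i only has to be absent from the chosen representative. *)
Definition is_renu (i j : Ind) (t r : tterm) : Prop :=
  exists t' r' : wterm,
    [/\ \pi_tterm t' = t, \pi_tterm r' = r, j \in FIu t,
        i \notin tup (val t') ++ tlow (val t')
      & val r' = [seq (if g is Edge x y w then Edge (repl i j x) y w else g)
                 | g <- val t']].

(* [is_renl i j t r]: r is t_{[i/j]}. *)
Definition is_renl (i j : Ind) (t r : tterm) : Prop :=
  exists t' r' : wterm,
    [/\ \pi_tterm t' = t, \pi_tterm r' = r, j \in FIl t,
        i \notin tup (val t') ++ tlow (val t')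
      & val r' = [seq (if g is Edge x y w then Edge x (repl i j y) w else g)
                 | g <- val t']].

(* A set of terms together with a boundary; [is_pretype] states that the boundary
   is the boundary of the elements. Operations are total on [ptype] and are used
   only where the boundary conditions of the corresponding definition hold. *)
Record ptype := PType {
  pu : {fset Ind};
  pl : {fset Ind};
  pset : set tterm
}.

Definition is_pretype (X : ptype) : Prop :=
  [disjoint pu X & pl X]%fset /\
  forall t, pset X t -> FIu t = pu X /\ FIl t = pl X.

Definition prenu (i j : Ind) (X : ptype) : ptype :=
  PType (i |` (pu X `\ j))%fset (pl X)
    [set r | exists2 t, pset X t & is_renu i j t r].
Definition prenl (i j : Ind) (X : ptype) : ptype :=
  PType (pu X) (i |` (pl X `\ j))%fset
    [set r | exists2 t, pset X t & is_renl i j t r].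

(* The boundary of a product: indices that are upper on one side and lower on
   the other become bound. *)
Definition bprod (U V L M : {fset Ind}) : {fset Ind} :=
  ((U `|` V) `\` (L `|` M))%fset.

Definition pmul (X Y : ptype) : ptype :=
  PType (bprod (pu X) (pu Y) (pl X) (pl Y)) (bprod (pl X) (pl Y) (pu X) (pu Y))
    [set r | exists t s, [/\ pset X t, pset Y s & is_prod t s r]].

Definition plolli (X Y : ptype) : ptype :=
  let U := bprod (pl X) (pu Y) (pu X) (pl Y) in
  let L := bprod (pu X) (pl Y) (pl X) (pu Y) in
  PType U L
    [set t | [/\ FIu t = U, FIl t = L
               & forall s, pset X s -> prod_in t s (pset Y)]].

Definition pdelta (x y : Ind) : ptype :=
  PType [fset x]%fset [fset y]%fset [set tdelta x y].

Section Dual.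
Variable D : ptype.

Definition pdual (X : ptype) : ptype :=
  PType (pl X) (pu X)
    [set s | [/\ FIu s = pl X, FIl s = pu X
               & forall t, pset X t -> prod_in t s (pset D)]].

Definition is_type (X : ptype) : Prop := is_pretype X /\ X = pdual (pdual X).

Definition ptensor (X Y : ptype) : ptype := pdual (pdual (pmul X Y)).
Definition ppar (X Y : ptype) : ptype := pdual (pmul (pdual X) (pdual Y)).

(* bot^x_y and 1^x_y *)
Definition pbot (x y : Ind) : ptype := pdual (pdelta y x).
Definition punit (x y : Ind) : ptype := pdual (pdual (pdelta x y)).

(* The empty cotensor product is the unit of the cotensor product, the
   dualizing type. *)
Fixpoint ppars (Xs : seq ptype) : ptype :=
  match Xs with
  | [::] => D
  | [:: X] => X
  | X :: Xs' => ppar X (ppars Xs')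
  end.

End Dual.
End Terms.

Record tsystem (Ind : choiceType) := TSystem {
  alphabet : choiceType;
  dualizing : ptype Ind alphabet;
  dualizing_pretype : is_pretype dualizing;
  dualizing_up : pu dualizing = fset0;
  dualizing_low : pl dualizing = fset0
}.

Section Languages.
Variables (Ind : choiceType) (Lit : Type) (v : Lit -> nat * nat).

Inductive lit := Pos of Lit | Neg of Lit.

Definition lit_dual (p : lit) : lit :=
  match p with Pos q => Neg q | Neg q => Pos q end.

Definition valency (p : lit) : nat * nat :=
  match p with Pos q => v q | Neg q => ((v q).2, (v q).1) end.

(* [CAtom p us ls] is p^{us}_{ls}; [COne i j] is 1^i_j; [CBot i j] is bot^i_j. *)
Inductive cform :=
| CAtom of lit & seq Ind & seq Ind
| COne of Ind & Ind
| CBot of Ind & Ind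
| CTens of cform & cform
| CPar of cform & cform.

Definition catomic (A : cform) : bool :=
  match A with CAtom _ _ _ | COne _ _ | CBot _ _ => true | _ => false end.

Fixpoint cdual (A : cform) : cform :=
  match A with
  | CAtom p us ls => CAtom (lit_dual p) (rev ls) (rev us)
  | COne i j => CBot j i
  | CBot i j => COne j i
  | CTens A B => CPar (cdual B) (cdual A)
  | CPar A B => CTens (cdual B) (cdual A)
  end.

Fixpoint cup (A : cform) : seq Ind :=
  match A with
  | CAtom _ us _ => us
  | COne i _ | CBot i _ => [:: i]
  | CTens A B | CPar A B => cup A ++ cup B
  end.

Fixpoint clow (A : cform) : seq Ind :=
  match A with
  | CAtom _ _ ls => ls
  | COne _ j | CBot _ j => [:: j]
  | CTens A B | CPar A B => clow A ++ clow B
  end.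

Fixpoint catoms_wf (A : cform) : bool :=
  match A with
  | CAtom p us ls =>
      [&& size us == (valency p).1, size ls == (valency p).2 & uniq (us ++ ls)]
  | COne i j | CBot i j => i != j
  | CTens A B | CPar A B => catoms_wf A && catoms_wf B
  end.

Definition cwf (A : cform) : bool :=
  [&& catoms_wf A, uniq (cup A) & uniq (clow A)].

Definition cFIu (A : cform) : {fset Ind} := once (cup A) (clow A).
Definition cFIl (A : cform) : {fset Ind} := once (clow A) (cup A).

(* A^{[i/j]}; every use has j \in cFIu A, so that exactly one occurrence is
   replaced, and a well-formed result, which for i outside the free indices of A
   excludes that i occurs in A at all. *)
Fixpoint csubu (i j : Ind) (A : cform) : cform :=
  match A with
  | CAtom p us ls => CAtom p (map (repl i j) us) ls
  | COne x y => COne (repl i j x) y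
  | CBot x y => CBot (repl i j x) y
  | CTens A B => CTens (csubu i j A) (csubu i j B)
  | CPar A B => CPar (csubu i j A) (csubu i j B)
  end.

(* A_{[i/j]} *)
Fixpoint csubl (i j : Ind) (A : cform) : cform :=
  match A with
  | CAtom p us ls => CAtom p us (map (repl i j) ls)
  | COne x y => COne x (repl i j y)
  | CBot x y => CBot x (repl i j y)
  | CTens A B => CTens (csubl i j A) (csubl i j B)
  | CPar A B => CPar (csubl i j A) (csubl i j B)
  end.

Definition cseq_wf (G : seq cform) : Prop :=
  [/\ all cwf G,
      pairwise (fun A B => [disjoint cFIu A & cFIu B]%fset) G,
      pairwise (fun A B => [disjoint cFIl A & cFIl B]%fset) G
    & \big[fsetU/fset0]_(A <- G) cFIu A = \big[fsetU/fset0]_(A <- G) cFIl A].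

(* Contexts are multisets: lists up to [Permutation]. *)
Inductive TTL : seq cform -> Prop :=
| TTL_perm G D : Permutation G D -> TTL G -> TTL D
| TTL_id A : catomic A -> cseq_wf [:: cdual A; A] -> TTL [:: cdual A; A]
| TTL_cut G D A : TTL (G ++ [:: A]) -> TTL (cdual A :: D) ->
    cseq_wf (G ++ D) -> TTL (G ++ D)
| TTL_tens G D A B : TTL (G ++ [:: A]) -> TTL (B :: D) ->
    cseq_wf (G ++ CTens A B :: D) -> TTL (G ++ CTens A B :: D)
| TTL_par G A B : TTL (G ++ [:: A; B]) ->
    cseq_wf (G ++ [:: CPar A B]) -> TTL (G ++ [:: CPar A B])
| TTL_botR G A i j : TTL (G ++ [:: A]) ->
    j \in cFIu A -> i \notin cFIu A -> i \notin cFIl A ->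
    cseq_wf (G ++ [:: CBot j i; csubu i j A]) ->
    TTL (G ++ [:: CBot j i; csubu i j A])
| TTL_botL G A i j : TTL (G ++ [:: A; CBot j i]) ->
    j \in cFIl A -> i \notin cFIu A -> i \notin cFIl A ->
    cseq_wf (G ++ [:: csubl i j A]) -> TTL (G ++ [:: csubl i j A]).

(* [IAtom p us ls] is p^{us}_{ls}; [IOne i j] is 1^i_j. *)
Inductive iform :=
| IAtom of Lit & seq Ind & seq Ind
| IOne of Ind & Ind
| ITens of iform & iform
| ILolli of iform & iform.

Definition iatomic (A : iform) : bool :=
  match A with IAtom _ _ _ | IOne _ _ => true | _ => false end.

(* The occurrences of upper ([b = true]) or lower ([b = false]) polarity. *)
Fixpoint iocc (b : bool) (A : iform) : seq Ind :=
  match A with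
  | IAtom _ us ls => if b then us else ls
  | IOne i j => if b then [:: i] else [:: j]
  | ITens A B => iocc b A ++ iocc b B
  | ILolli A B => iocc (~~ b) A ++ iocc b B
  end.

Definition atom_wf (p : Lit) (us ls : seq Ind) : bool :=
  [&& size us == (v p).1, size ls == (v p).2 & uniq (us ++ ls)].

Fixpoint iatoms_wf (A : iform) : bool :=
  match A with
  | IAtom p us ls => atom_wf p us ls
  | IOne i j => i != j
  | ITens A B | ILolli A B => iatoms_wf A && iatoms_wf B
  end.

Definition iwf (A : iform) : bool :=
  [&& iatoms_wf A, uniq (iocc true A) & uniq (iocc false A)].

Definition iFIu (A : iform) : {fset Ind} := once (iocc true A) (iocc false A).
Definition iFIl (A : iform) : {fset Ind} := once (iocc false A) (iocc true A).

(* Substitution of i for the occurrence of j of polarity b, under the same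
   provisos as [csubu]. *)
Fixpoint isub (b : bool) (i j : Ind) (A : iform) : iform :=
  match A with
  | IAtom p us ls => if b then IAtom p (map (repl i j) us) ls
                     else IAtom p us (map (repl i j) ls)
  | IOne x y => if b then IOne (repl i j x) y else IOne x (repl i j y)
  | ITens A B => ITens (isub b i j A) (isub b i j B)
  | ILolli A B => ILolli (isub (~~ b) i j A) (isub b i j B)
  end.
Definition isubu := isub true.
Definition isubl := isub false.

Definition iFIus (G : seq iform) : {fset Ind} := \big[fsetU/fset0]_(A <- G) iFIu A.
Definition iFIls (G : seq iform) : {fset Ind} := \big[fsetU/fset0]_(A <- G) iFIl A.

Definition iseq_wf (G : seq iform) (A : iform) : Prop :=
  [/\ all iwf G && iwf A,
      pairwise (fun A B => [disjoint iFIu A & iFIu B]%fset) G,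
      pairwise (fun A B => [disjoint iFIl A & iFIl B]%fset) G,
      [disjoint iFIus G & iFIl A]%fset && [disjoint iFIls G & iFIu A]%fset
    & (iFIus G `|` iFIl A)%fset = (iFIls G `|` iFIu A)%fset].

Inductive ITTL : seq iform -> iform -> Prop :=
| ITTL_perm G D A : Permutation G D -> ITTL G A -> ITTL D A
| ITTL_id A : iatomic A -> iseq_wf [:: A] A -> ITTL [:: A] A
| ITTL_cut G D A B : ITTL G A -> ITTL (A :: D) B ->
    iseq_wf (G ++ D) B -> ITTL (G ++ D) B
| ITTL_lolliL G D A B C : ITTL G A -> ITTL (B :: D) C ->
    iseq_wf (G ++ ILolli A B :: D) C -> ITTL (G ++ ILolli A B :: D) C
| ITTL_lolliR G A B : ITTL (G ++ [:: A]) B ->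
    iseq_wf G (ILolli A B) -> ITTL G (ILolli A B)
| ITTL_tensL G A B C : ITTL (G ++ [:: A; B]) C ->
    iseq_wf (G ++ [:: ITens A B]) C -> ITTL (G ++ [:: ITens A B]) C
| ITTL_tensR G D A B : ITTL G A -> ITTL D B ->
    iseq_wf (G ++ D) (ITens A B) -> ITTL (G ++ D) (ITens A B)
| ITTL_oneL_intro G A B i j : ITTL (G ++ [:: A]) B ->
    j \in iFIl A -> i \notin iFIu A -> i \notin iFIl A ->
    iseq_wf (G ++ [:: isubl i j A; IOne i j]) B ->
    ITTL (G ++ [:: isubl i j A; IOne i j]) B
| ITTL_oneR_intro G A i j : ITTL G A ->
    j \in iFIu A -> i \notin iFIu A -> i \notin iFIl A ->
    iseq_wf (IOne i j :: G) (isubu i j A) ->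
    ITTL (IOne i j :: G) (isubu i j A)
| ITTL_oneL_elim G A B i j : ITTL (G ++ [:: IOne i j; A]) B ->
    j \in iFIu A -> i \notin iFIu A -> i \notin iFIl A ->
    iseq_wf (G ++ [:: isubu i j A]) B -> ITTL (G ++ [:: isubu i j A]) B
| ITTL_oneR_elim G A i j : ITTL (G ++ [:: IOne i j]) A ->
    j \in iFIl A -> i \notin iFIu A -> i \notin iFIl A ->
    iseq_wf G (isubl i j A) -> ITTL G (isubl i j A).

(* The valuation is only meaningful on the atomic formulas p^{us}_{ls}, that is,
   under [atom_wf p us ls]. *)
Record model := Model {
  msys : tsystem Ind;
  mval : Lit -> seq Ind -> seq Ind -> ptype Ind (alphabet msys);
  mval_type : forall p us ls, atom_wf p us ls ->
    is_type (dualizing msys) (mval p us ls);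
  mval_up : forall p us ls, atom_wf p us ls ->
    pu (mval p us ls) = [fset x in us]%fset;
  mval_low : forall p us ls, atom_wf p us ls ->
    pl (mval p us ls) = [fset x in ls]%fset;
  mval_subu : forall p us ls i j, atom_wf p us ls ->
    j \in us -> i \notin us ++ ls ->
    mval p (map (repl i j) us) ls = prenu i j (mval p us ls);
  mval_subl : forall p us ls i j, atom_wf p us ls ->
    j \in ls -> i \notin us ++ ls ->
    mval p us (map (repl i j) ls) = prenl i j (mval p us ls)
}.

Section Interpretation.
Variable M : model.
Let D := dualizing (msys M).

Fixpoint cinterp (A : cform) : ptype Ind (alphabet (msys M)) :=
  match A with
  | CAtom (Pos p) us ls => mval M p us ls
  | CAtom (Neg p) us ls => pdual D (mval M p (rev ls) (rev us))
  | COne i j => punit D i j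
  | CBot i j => pbot D i j
  | CTens A B => ptensor D (cinterp A) (cinterp B)
  | CPar A B => ppar D (cinterp A) (cinterp B)
  end.

Fixpoint iinterp (A : iform) : ptype Ind (alphabet (msys M)) :=
  match A with
  | IAtom p us ls => mval M p us ls
  | IOne i j => punit D i j
  | ITens A B => ptensor D (iinterp A) (iinterp B)
  | ILolli A B => plolli (iinterp A) (iinterp B)
  end.

(* 1 belongs to the cotensor product of the interpretations. *)
Definition cvalid (G : seq cform) : Prop :=
  pset (ppars D (map cinterp G)) (tone Ind (alphabet (msys M))).

(* t_1 ... t_n belongs to the type of the succedent whenever each t_k belongs
   to the type of the k-th antecedent. *)
Definition ivalid (G : seq iform) (A : iform) : Prop :=
  forall ts : seq (tterm Ind (alphabet (msys M))),
    List.Forall2 (fun t B => pset (iinterp B) t) ts G ->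
    exists2 r, is_prods ts r & pset (iinterp A) r.

End Interpretation.
End Languages.

(* Main.v *)
(* Gluing removes every bound index from a pseudo-term without introducing new
   indices, so each tensor term has a representative all of whose indices are
   free. Multiplying such representatives never requires renaming; hence the
   product of terms is a partial operation that is commutative, and associative
   on triples of pairwise composable terms. Renaming an index of a term is
   multiplication by a Kronecker delta: t^{[i/j]} = t delta^i_j and
   t_{[i/j]} = t delta^j_i.

   A sequent is sound when every product of elements of the duals of its
   formulas lies in the dualizing type. Since types are biduals, soundness of
   |- G, A says that the products of elements of the duals of G belong to A, and
   each rule of TTL becomes a computation with products; in the rules for bot
   the renaming is absorbed by the delta in bot^j_i = dual {delta^i_j}. ITTL is
   reduced to TTL by reading A -o B as the cotensor product of the dual of A
   with B, which does not change the interpretation. *)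

Require Import Defs.
From mathcomp Require Import all_boot finmap generic_quotient.
From mathcomp Require Import boolp classical_sets cardinality zify.
From Stdlib Require Import Permutation.

Set Implicit Arguments.
Unset Strict Implicit.
Unset Printing Implicit Defensive.

Local Open Scope quotient_scope.

(** * Pseudo-terms without bound indices *)

(** The obstacle is partiality. [tcong] relates well-formed pseudo-terms only, so a factor of a
    concatenation may be rewritten only if the intermediate concatenations are well-formed. Nor does
    it suffice for associativity that both bracketings are defined: for t = [a]^x_y, s = [b]^z_x, r
    = [c]^x_w the upper x of t is glued to s in (ts)r, and the upper x of r is glued to s in t(sr),
    with different results. Such clashes are excluded by composability of t and r, and this is what
    well-formed sequents supply: elements of the duals of the formulas of a context are pairwise
    composable. Most side goals are therefore statements about finite index sets. The balance of
    free upper and free lower indices in a sequent has a separate purpose. It forces a product of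
    elements of the duals of all formulas but one to have the boundary of the remaining formula,
    which membership in a bidual demands. *)

Section Reduction.
Variables (Ind T : choiceType).
Implicit Types (p q r : pterm Ind T) (x : Ind).

Lemma tup_cat p q : tup (p ++ q) = tup p ++ tup q.
Proof. by rewrite /tup map_cat flatten_cat. Qed.

Lemma tlow_cat p q : tlow (p ++ q) = tlow p ++ tlow q.
Proof. by rewrite /tlow map_cat flatten_cat. Qed.

Lemma perm_tup p q : perm_eq p q -> perm_eq (tup p) (tup q).
Proof. by move=> pq; apply/perm_flatten/perm_map. Qed.

Lemma perm_tlow p q : perm_eq p q -> perm_eq (tlow p) (tlow q).
Proof. by move=> pq; apply/perm_flatten/perm_map. Qed.

Lemma perm_pwf p q : perm_eq p q -> pwf p = pwf q.
Proof.
by move=> pq; rewrite /pwf (perm_uniq (perm_tup pq)) (perm_uniq (perm_tlow pq)).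
Qed.

Lemma pwf_cat p q : pwf (p ++ q) =
  [&& pwf p, pwf q, ~~ has (mem (tup p)) (tup q)
    & ~~ has (mem (tlow p)) (tlow q)].
Proof.
rewrite /pwf tup_cat tlow_cat !cat_uniq.
by do 4![case: (uniq _)]; rewrite /= ?andbT ?andbF.
Qed.

Lemma mem_tup x p : x \in tup p -> exists i w, Edge x i w \in p.
Proof.
case/flatten_mapP => -[j i w|w] //= pg; rewrite inE => /eqP ->.
by exists i, w.
Qed.

Lemma mem_tlow x p : x \in tlow p -> exists i w, Edge i x w \in p.
Proof.
case/flatten_mapP => -[j i w|w] //= pg; rewrite inE => /eqP ->.
by exists j, w.
Qed.

Lemma tcong_refl p : pwf p -> tcong p p.
Proof. by move=> wp; apply: tcong_perm. Qed.

Lemma tcong_pwf p q : tcong p q -> pwf p /\ pwf q.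
Proof. by elim=> // [? ? _ []|? ? ? _ [? ?] _ []]. Qed.

(** A contraction creates no index, so it cannot introduce a clash with the context [r]; this
    supplies the well-formedness that [tcong_mul] asks for. *)
Lemma tcong_contract p p' r : trule p p' -> pwf (p ++ r) -> pwf p' ->
  {subset tup p' <= tup p} -> {subset tlow p' <= tlow p} ->
  tcong (p ++ r) (p' ++ r).
Proof.
move=> ru wpr wp' su sl; have := wpr; rewrite pwf_cat => /and4P[wp wr du dl].
apply: tcong_mul => //; last exact: tcong_rule.
rewrite pwf_cat wp' wr /=; apply/andP; split; apply/hasPn => x xr; apply/negP.
  by move/su => xp; move/hasPn/(_ x xr)/negP: du; apply.
by move/sl => xp; move/hasPn/(_ x xr)/negP: dl; apply.
Qed.

Definition reduced p := ~~ has (mem (tup p)) (tlow p).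

(** Each gluing or closing lowers the number of upper occurrences by one, so contracting bound
    indices terminates. *)
Lemma tcong_reduced p : pwf p -> exists2 q, tcong p q & reduced q.
Proof.
have [n] := ubnP (size (tup p)); elim: n p => // n IH p lep wp.
have [rp|] := boolP (reduced p); first by exists p => //; apply: tcong_refl.
rewrite negbK => /hasP[x xl xu].
suff [q pq lq] : exists2 q, tcong p q & (size (tup q) < size (tup p))%N.
  have [_ wq] := tcong_pwf pq.
  have [|q' qq' rq'] := IH q _ wq; first by lia.
  by exists q' => //; apply: tcong_trans qq'.
have [i [u pu]] := mem_tup xu; have [k [w pw]] := mem_tlow xl.
have p1 := perm_to_rem pu.
have wperm r : perm_eq p r -> tcong p r.
  by move=> pr; apply: tcong_perm; rewrite -?(perm_pwf pr).
(* If both occurrences of the bound index lie on one edge, it closes to a loop; otherwise two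
   distinct edges are glued. *)
have [xx|xx] := eqVneq (Edge k x w) (Edge x i u).
  case: xx p1 => _ {k pw} <- <- p1.
  exists ([:: Loop Ind w] ++ rem (Edge x x w) p); last first.
    by rewrite (perm_size (perm_tup p1)).
  apply: (tcong_trans (wperm _ p1)); rewrite -cat1s.
  apply: tcong_contract => //; first exact: trule_close.
  by rewrite -(perm_pwf p1).
have p2 : perm_eq p ([:: Edge k x w; Edge x i u] ++
    rem (Edge k x w) (rem (Edge x i u) p)).
  rewrite (permPl p1) perm_sym.
  rewrite -[_ ++ _]/([:: Edge k x w] ++ [:: Edge x i u] ++ _).
  rewrite perm_catCA perm_sym perm_cons; apply: perm_to_rem.
  by move: pw; rewrite (perm_mem p1) inE (negPf xx).
exists ([:: Edge k i (w ++ u)] ++ rem (Edge k x w) (rem (Edge x i u) p)).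
  apply: (tcong_trans (wperm _ p2)).
  apply: tcong_contract => //; first exact: trule_glue.
  - by rewrite -(perm_pwf p2).
  - by move=> y; rewrite !inE => ->.
  - by move=> y; rewrite !inE => ->; rewrite orbT.
by rewrite (perm_size (perm_tup p2)) /=.
Qed.

(** [tcong_mul] rewrites the left factor only, so the right one is reached by commuting. The path
    passes through [p' ++ q], whose well-formedness is therefore assumed as well. *)
Lemma tcong_cat2 p p' q q' : pwf (p ++ q) -> pwf (p' ++ q) -> pwf (p' ++ q') ->
  tcong p p' -> tcong q q' -> tcong (p ++ q) (p' ++ q').
Proof.
move=> w1 w2 w3 pp qq; apply: (tcong_trans (tcong_mul w1 w2 pp)).
have cat_com r s : pwf (r ++ s) -> tcong (r ++ s) (s ++ r).
  have rs : perm_eq (r ++ s) (s ++ r) by rewrite perm_catC.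
  by move=> w; apply: tcong_perm => //; rewrite -(perm_pwf rs).
apply: (tcong_trans (cat_com _ _ w2)); apply: tcong_sym.
apply: (tcong_trans (cat_com _ _ w3)); apply: tcong_sym.
by apply: tcong_mul; rewrite // (perm_pwf (permEl (perm_catC _ _))).
Qed.

End Reduction.

(** * The product of tensor terms *)

Lemma in_bprod (K : choiceType) (U V L M : {fset K}) x :
  (x \in bprod U V L M) = ((x \in U) || (x \in V)) && ~~ ((x \in L) || (x \in M)).
Proof. by rewrite !inE andbC. Qed.

Section Product.
Variables (Ind T : choiceType).
Local Notation tt := (tterm Ind T).
Local Notation wt := (wterm Ind T).
Implicit Types (t s r : tt) (a b c : wt) (x i j : Ind).

Lemma pi_eqP a b : reflect (tcong (val a) (val b)) (\pi_tt a == \pi_tt b :> tt).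
Proof.
apply: (iffP idP) => [/eqP/eqmodP/asboolP //|ab].
by apply/eqP/eqmodP/asboolP.
Qed.

Lemma FIu_pi a : FIu (\pi_tt a) = once (tup (val a)) (tlow (val a)).
Proof.
have /pi_eqP/tcong_free[] // : \pi_tt (repr (\pi_tt a)) == \pi_tt a by rewrite reprK.
Qed.

Lemma FIl_pi a : FIl (\pi_tt a) = once (tlow (val a)) (tup (val a)).
Proof.
have /pi_eqP/tcong_free[] // : \pi_tt (repr (\pi_tt a)) == \pi_tt a by rewrite reprK.
Qed.

Lemma in_FIu_pi a x :
  (x \in FIu (\pi_tt a)) = (x \in tup (val a)) && (x \notin tlow (val a)).
Proof. by rewrite FIu_pi in_once //; have /andP[] := valP a. Qed.

Lemma in_FIl_pi a x :
  (x \in FIl (\pi_tt a)) = (x \in tlow (val a)) && (x \notin tup (val a)).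
Proof. by rewrite FIl_pi in_once //; have /andP[] := valP a. Qed.

Lemma disj_FI t : [disjoint FIu t & FIl t]%fset.
Proof.
rewrite -[t]reprK; apply/fdisjointP => x.
by rewrite in_FIu_pi in_FIl_pi => /andP[-> _]; rewrite andbF.
Qed.

Lemma reduced_ex t : exists a, \pi_tt a = t /\ reduced (val a).
Proof.
have [q tq rq] := tcong_reduced (valP (repr t)).
have [_ wq] := tcong_pwf tq.
exists (Sub q wq); split; last by rewrite SubK.
by rewrite -[RHS]reprK; apply/eqP/pi_eqP; rewrite SubK; apply: tcong_sym.
Qed.

(** An arbitrary choice among the reduced representatives, not a canonical form. What matters is
    that its upper and lower indices are exactly the boundary of the term. *)
Definition nf t : wt := projT1 (cid (reduced_ex t)).

Lemma nfK t : \pi_tt (nf t) = t.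
Proof. by rewrite /nf; case: cid => a []. Qed.

Lemma reduced_nf t : reduced (val (nf t)).
Proof. by rewrite /nf; case: cid => a []. Qed.

Lemma mem_tup_nf t x : (x \in tup (val (nf t))) = (x \in FIu t).
Proof.
rewrite -[in RHS](nfK t) in_FIu_pi; case: (boolP (_ \in tup _)) => //= xu.
by apply/esym/negP => xl; have /negP[] := reduced_nf t; apply/hasP; exists x.
Qed.

Lemma mem_tlow_nf t x : (x \in tlow (val (nf t))) = (x \in FIl t).
Proof.
rewrite -[in RHS](nfK t) in_FIl_pi; case: (boolP (_ \in tlow _)) => //= xl.
by apply/esym/negP => xu; have /negP[] := reduced_nf t; apply/hasP; exists x.
Qed.

Definition compat t s :=
  [disjoint FIu t & FIu s]%fset && [disjoint FIl t & FIl s]%fset.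

Lemma compatC t s : compat t s = compat s t.
Proof. by rewrite /compat (fdisjoint_sym (FIu t)) (fdisjoint_sym (FIl t)). Qed.

(** If [compat] fails, the concatenation is ill-formed and [insubd] falls back on the unit, a junk
    value. *)
Definition tmul t s : tt :=
  \pi_tt (insubd (wone Ind T) (val (nf t) ++ val (nf s))).

Lemma is_prod_pi a b c : val c = val a ++ val b ->
  is_prod (\pi_tt a) (\pi_tt b) (\pi_tt c).
Proof. by exists a, b, c. Qed.

Lemma pwf_nf_cat t b :
  (forall x, x \in tup (val b) -> x \notin FIu t) ->
  (forall x, x \in tlow (val b) -> x \notin FIl t) ->
  pwf (val (nf t) ++ val b).
Proof.
move=> du dl; rewrite pwf_cat !valP /=; apply/andP; split; apply/hasPn => x.
  by rewrite /= mem_tup_nf; apply: du.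
by rewrite /= mem_tlow_nf; apply: dl.
Qed.

Lemma pwf_nf2 t s : compat t s -> pwf (val (nf t) ++ val (nf s)).
Proof.
rewrite compatC => /andP[/fdisjointP du /fdisjointP dl].
by apply: pwf_nf_cat => x; rewrite ?mem_tup_nf ?mem_tlow_nf => xs;
  rewrite ?du ?dl.
Qed.

(** The product does not depend on representatives: the left one is replaced by its reduced form,
    then the right one. The concatenations on the way stay well-formed because a reduced form uses
    free indices only. *)
Lemma is_prodP t s r : is_prod t s r <-> compat t s /\ r = tmul t s.
Proof.
split=> [[a [b [c [<- <- <- abc]]]]|[ts ->]]; last first.
  rewrite -[t in is_prod t](nfK t) -[s in is_prod _ s](nfK s).
  by apply: is_prod_pi; rewrite insubdK //; apply: pwf_nf2.
have := valP c; rewrite /= abc => wab.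
have /and4P[wa wb /hasPn du /hasPn dl] : [&& pwf (val a), pwf (val b),
   ~~ has (mem (tup (val a))) (tup (val b))
    & ~~ has (mem (tlow (val a))) (tlow (val b))] by rewrite -pwf_cat.
have w1 : pwf (val (nf (\pi_tt a)) ++ val b).
  apply: pwf_nf_cat => x xb; rewrite ?in_FIu_pi ?in_FIl_pi negb_and.
    by rewrite (du _ xb).
  by rewrite (dl _ xb).
have cab : compat (\pi_tt a) (\pi_tt b).
  apply/andP; split; rewrite fdisjoint_sym; apply/fdisjointP => x.
    by rewrite !in_FIu_pi negb_and => /andP[/du ->].
  by rewrite !in_FIl_pi negb_and => /andP[/dl ->].
split=> //; apply/eqP/pi_eqP; rewrite abc insubdK; last exact: pwf_nf2.
apply: tcong_cat2 => //; first exact: pwf_nf2.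
  by apply/pi_eqP; rewrite nfK.
by apply/pi_eqP; rewrite nfK.
Qed.

Lemma pi_nf2 t s : compat t s ->
  exists2 a, \pi_tt a = tmul t s & val a = val (nf t) ++ val (nf s).
Proof.
move=> ts; exists (insubd (wone Ind T) (val (nf t) ++ val (nf s))) => //.
by rewrite insubdK //; apply: pwf_nf2.
Qed.

Lemma FIu_mul t s : compat t s ->
  FIu (tmul t s) = bprod (FIu t) (FIu s) (FIl t) (FIl s).
Proof.
move=> /pi_nf2[a <- av]; apply/fsetP => x.
by rewrite in_FIu_pi av tup_cat tlow_cat !mem_cat !mem_tup_nf !mem_tlow_nf
  in_bprod.
Qed.

Lemma FIl_mul t s : compat t s ->
  FIl (tmul t s) = bprod (FIl t) (FIl s) (FIu t) (FIu s).
Proof.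
move=> /pi_nf2[a <- av]; apply/fsetP => x.
by rewrite in_FIl_pi av tup_cat tlow_cat !mem_cat !mem_tup_nf !mem_tlow_nf
  in_bprod.
Qed.

Lemma tmulC t s : compat t s -> tmul t s = tmul s t.
Proof.
move=> ts; have st : compat s t by rewrite compatC.
have [[a <- av] [b <- bv]] := (pi_nf2 ts, pi_nf2 st).
by apply/eqP/pi_eqP/tcong_perm; rewrite ?valP // av bv perm_catC.
Qed.

Lemma compat_tmul t s r : compat t s -> compat t r -> compat s r ->
  compat t (tmul s r).
Proof.
move=> /andP[/fdisjointP u1 /fdisjointP l1] /andP[/fdisjointP u2 /fdisjointP l2] sr.
rewrite /compat FIu_mul // FIl_mul //.
apply/andP; split; apply/fdisjointP => x xt;
    rewrite in_bprod negb_and negb_or.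
  by rewrite u1 // u2.
by rewrite l1 // l2.
Qed.

(** A single concatenation of three reduced representatives represents both bracketings. *)
Lemma tmulA t s r : compat t s -> compat t r -> compat s r ->
  tmul t (tmul s r) = tmul (tmul t s) r.
Proof.
move=> ts tr sr.
have [[a ea av] [b eb bv]] := (pi_nf2 ts, pi_nf2 sr).
have cr : compat t (tmul s r) by apply: compat_tmul.
have wtsr : pwf (val (nf t) ++ val b).
  move: cr; rewrite compatC -eb => /andP[/fdisjointP u /fdisjointP l].
  apply: pwf_nf_cat => x xb.
    (* An index bound in [b] is invisible in the boundary of [tmul s r]; it is excluded through
       composability of [t] with [s] and with [r]. *)
    have [?|?] := boolP (x \in tlow (val b)); last by apply: u; rewrite in_FIu_pi xb.
    case/andP: ts tr => /fdisjointP u1 /fdisjointP l1 /andP[/fdisjointP u2 /fdisjointP l2].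
    by move: xb; rewrite bv tup_cat mem_cat !mem_tup_nf => xb;
      apply: contraL xb => xt; rewrite negb_or u1 // u2.
  have [?|?] := boolP (x \in tup (val b)); last by apply: l; rewrite in_FIl_pi xb.
  case/andP: ts tr => /fdisjointP u1 /fdisjointP l1 /andP[/fdisjointP u2 /fdisjointP l2].
  by move: xb; rewrite bv tlow_cat mem_cat !mem_tlow_nf => xb;
    apply: contraL xb => xt; rewrite negb_or l1 // l2.
pose c : wt := Sub _ wtsr.
have /is_prodP[_ <-] : is_prod t (tmul s r) (\pi_tt c).
  rewrite -[t in is_prod t](nfK t) -eb; exact: is_prod_pi.
have /is_prodP[_ <-] // : is_prod (tmul t s) r (\pi_tt c).
rewrite -[r in is_prod _ r](nfK r) -ea; apply: is_prod_pi.
by rewrite /= bv av catA.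
Qed.

Lemma FIu_tone : FIu (tone Ind T) = fset0.
Proof. by apply/fsetP => x; rewrite in_FIu_pi inE. Qed.

Lemma FIl_tone : FIl (tone Ind T) = fset0.
Proof. by apply/fsetP => x; rewrite in_FIl_pi inE. Qed.

Lemma compat_tone t : compat t (tone Ind T).
Proof.
by rewrite /compat FIu_tone FIl_tone; apply/andP; split; apply/fdisjointP.
Qed.

Lemma tmult1 t : tmul t (tone Ind T) = t.
Proof.
have /is_prodP[_ <-] // : is_prod t (tone Ind T) t.
by rewrite -(nfK t); apply: is_prod_pi; rewrite cats0.
Qed.

(** * Kronecker deltas and the renaming of indices in terms *)

Lemma FIu_tdelta i j : i != j -> FIu (tdelta T i j) = [fset i]%fset.
Proof.
move=> ij; apply/fsetP => x; rewrite in_FIu_pi /= !inE.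
by case: eqVneq => [->|].
Qed.

Lemma FIl_tdelta i j : i != j -> FIl (tdelta T i j) = [fset j]%fset.
Proof.
move=> ij; apply/fsetP => x; rewrite in_FIl_pi /= !inE eq_sym.
by case: eqVneq => [<-|]; rewrite // eq_sym ij.
Qed.

Lemma compat_tdelta i j t : i != j ->
  compat t (tdelta T i j) = (i \notin FIu t) && (j \notin FIl t).
Proof. by move=> ij; rewrite /compat FIu_tdelta // FIl_tdelta // !fdisjointX1. Qed.

Definition renu i j (g : symb Ind T) :=
  if g is Edge x y w then Edge (repl i j x) y w else g.

Definition renl i j (g : symb Ind T) :=
  if g is Edge x y w then Edge x (repl i j y) w else g.

Lemma tup_renu i j (p : pterm Ind T) :
  tup (map (renu i j) p) = map (repl i j) (tup p).
Proof.
elim: p => // g p IH; rewrite map_cons -(cat1s g p) -(cat1s (renu i j g)).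
by rewrite !tup_cat IH map_cat; case: g.
Qed.

Lemma tlow_renu i j (p : pterm Ind T) : tlow (map (renu i j) p) = tlow p.
Proof.
elim: p => // g p IH; rewrite map_cons -(cat1s g p) -(cat1s (renu i j g)).
by rewrite !tlow_cat IH; case: g.
Qed.

Lemma tup_renl i j (p : pterm Ind T) : tup (map (renl i j) p) = tup p.
Proof.
elim: p => // g p IH; rewrite map_cons -(cat1s g p) -(cat1s (renl i j g)).
by rewrite !tup_cat IH; case: g.
Qed.

Lemma tlow_renl i j (p : pterm Ind T) :
  tlow (map (renl i j) p) = map (repl i j) (tlow p).
Proof.
elim: p => // g p IH; rewrite map_cons -(cat1s g p) -(cat1s (renl i j g)).
by rewrite !tlow_cat IH map_cat; case: g.
Qed.

Lemma map_renu_id i j (p : pterm Ind T) : j \notin tup p -> map (renu i j) p = p.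
Proof.
elim: p => // -[x y w|w] p IH /=; last by move/IH ->.
by rewrite inE negb_or /repl eq_sym => /andP[/negPf -> /IH ->].
Qed.

Lemma map_renl_id i j (p : pterm Ind T) : j \notin tlow p -> map (renl i j) p = p.
Proof.
elim: p => // -[x y w|w] p IH /=; last by move/IH ->.
by rewrite inE negb_or /repl eq_sym => /andP[/negPf -> /IH ->].
Qed.

Lemma uniq_repl i j (l : seq Ind) : i \notin l -> uniq l -> uniq (map (repl i j) l).
Proof.
move=> il ul; rewrite map_inj_in_uniq // => x y xl yl; rewrite /repl.
case: eqVneq => [->|_]; case: eqVneq => [->|_] // e.
  by move: il; rewrite e yl.
by move: il; rewrite -e xl.
Qed.

(** The index [j] is upper on exactly one edge [w]^j_k; gluing delta^i_j in front of it gives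
    [w]^i_k, and renaming fixes the remaining symbols. *)
Lemma tcong_renu i j (p : pterm Ind T) :
  pwf p -> j \in tup p -> j \notin tlow p -> i \notin tup p ++ tlow p ->
  tcong (p ++ [:: Edge i j [::]]) (map (renu i j) p).
Proof.
move=> wp ju jl; rewrite mem_cat negb_or => /andP[iu il].
have /andP[up lp] := wp.
have [k [w pw]] := mem_tup ju; have p1 := perm_to_rem pw.
have wr : pwf (map (renu i j) p).
  by rewrite /pwf tup_renu tlow_renu lp andbT uniq_repl.
have wpe : pwf (p ++ [:: Edge i j [::]]).
  by rewrite pwf_cat wp /= !orbF iu jl.
have jr : j \notin tup (rem (Edge j k w) p).
  by move: up; rewrite (perm_uniq (perm_tup p1)) /= => /andP[].
have r1 : perm_eq (map (renu i j) p) ([:: Edge i k w] ++ rem (Edge j k w) p).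
  by rewrite (permPl (perm_map (renu i j) p1)) /= map_renu_id // /repl eqxx.
have e1 : perm_eq (p ++ [:: Edge i j [::]])
    ([:: Edge i j [::]; Edge j k w] ++ rem (Edge j k w) p).
  by rewrite perm_catC /= perm_cons.
have w1 : pwf ([:: Edge i k w] ++ rem (Edge j k w) p) by rewrite -(perm_pwf r1).
have w2 : pwf ([:: Edge i j [::]; Edge j k w] ++ rem (Edge j k w) p).
  by rewrite -(perm_pwf e1).
apply: (tcong_trans (tcong_perm wpe w2 e1)).
apply: tcong_sym; apply: (tcong_trans (tcong_perm wr w1 r1)).
apply: tcong_sym; apply: tcong_mul => //; apply: tcong_rule => //.
  by have := w2; rewrite pwf_cat => /and4P[].
exact: (trule_glue [::]).
Qed.

Lemma tcong_renl i j (p : pterm Ind T) :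
  pwf p -> j \in tlow p -> j \notin tup p -> i \notin tup p ++ tlow p ->
  tcong (p ++ [:: Edge j i [::]]) (map (renl i j) p).
Proof.
move=> wp jl ju; rewrite mem_cat negb_or => /andP[iu il].
have /andP[up lp] := wp.
have [k [w pw]] := mem_tlow jl; have p1 := perm_to_rem pw.
have wr : pwf (map (renl i j) p).
  by rewrite /pwf tup_renl tlow_renl up uniq_repl.
have wpe : pwf (p ++ [:: Edge j i [::]]).
  by rewrite pwf_cat wp /= !orbF il ju.
have jr : j \notin tlow (rem (Edge k j w) p).
  by move: lp; rewrite (perm_uniq (perm_tlow p1)) /= => /andP[].
have r1 : perm_eq (map (renl i j) p) ([:: Edge k i w] ++ rem (Edge k j w) p).
  by rewrite (permPl (perm_map (renl i j) p1)) /= map_renl_id // /repl eqxx.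
have e1 : perm_eq (p ++ [:: Edge j i [::]])
    ([:: Edge k j w; Edge j i [::]] ++ rem (Edge k j w) p).
  rewrite perm_catC -cat1s perm_sym.
  rewrite -[X in perm_eq X]/([:: Edge k j w] ++ [:: Edge j i [::]] ++ _).
  by rewrite perm_catCA perm_cons perm_sym.
have w1 : pwf ([:: Edge k i w] ++ rem (Edge k j w) p) by rewrite -(perm_pwf r1).
have w2 : pwf ([:: Edge k j w; Edge j i [::]] ++ rem (Edge k j w) p).
  by rewrite -(perm_pwf e1).
apply: (tcong_trans (tcong_perm wpe w2 e1)).
apply: tcong_sym; apply: (tcong_trans (tcong_perm wr w1 r1)).
apply: tcong_sym; apply: tcong_mul => //; apply: tcong_rule => //.
  by have := w2; rewrite pwf_cat => /and4P[].
(* Here the delta is glued behind the word, so its empty word has to be exhibited on the right. *)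
by rewrite -[in Edge k i w](cats0 w); apply: trule_glue.
Qed.

(** [is_renu] wants [i] absent from a representative, bound occurrences included; the reduced
    representative qualifies as soon as [i] is not free in [t]. *)
Lemma is_renuP i j t r : j \in FIu t -> i \notin FIu t -> i \notin FIl t ->
  is_renu i j t r <-> r = tmul t (tdelta T i j).
Proof.
move=> jt iu il.
have key a b : \pi_tt a = t -> i \notin tup (val a) ++ tlow (val a) ->
    val b = map (renu i j) (val a) -> \pi_tt b = tmul t (tdelta T i j).
  move=> at_ ia ba; move: jt; rewrite -at_ in_FIu_pi => /andP[ju jl].
  have tc := tcong_renu (valP a) ju jl ia.
  have [wp _] := tcong_pwf tc.
  have /is_prodP[_ <-] : is_prod (\pi_tt a) (tdelta T i j) (\pi_tt (Sub _ wp)).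
    exact: is_prod_pi.
  by apply/eqP/pi_eqP; rewrite ba; apply: tcong_sym.
split=> [[a [b [ta <- _ ia ba]]]|->]; first exact: key ta ia ba.
have inf : i \notin tup (val (nf t)) ++ tlow (val (nf t)).
  by rewrite mem_cat mem_tup_nf mem_tlow_nf negb_or iu.
have wr : pwf (map (renu i j) (val (nf t))).
  have /andP[up lp] := valP (nf t).
  rewrite /pwf tup_renu tlow_renu lp andbT uniq_repl //.
  by rewrite mem_tup_nf.
exists (nf t), (Sub _ wr); split=> //; first exact: nfK.
by apply: (key (nf t)); rewrite ?nfK.
Qed.

Lemma is_renlP i j t r : j \in FIl t -> i \notin FIu t -> i \notin FIl t ->
  is_renl i j t r <-> r = tmul t (tdelta T j i).
Proof.
move=> jt iu il.
have key a b : \pi_tt a = t -> i \notin tup (val a) ++ tlow (val a) ->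
    val b = map (renl i j) (val a) -> \pi_tt b = tmul t (tdelta T j i).
  move=> at_ ia ba; move: jt; rewrite -at_ in_FIl_pi => /andP[jl ju].
  have tc := tcong_renl (valP a) jl ju ia.
  have [wp _] := tcong_pwf tc.
  have /is_prodP[_ <-] : is_prod (\pi_tt a) (tdelta T j i) (\pi_tt (Sub _ wp)).
    exact: is_prod_pi.
  by apply/eqP/pi_eqP; rewrite ba; apply: tcong_sym.
split=> [[a [b [ta <- _ ia ba]]]|->]; first exact: key ta ia ba.
have inf : i \notin tup (val (nf t)) ++ tlow (val (nf t)).
  by rewrite mem_cat mem_tup_nf mem_tlow_nf negb_or iu.
have wr : pwf (map (renl i j) (val (nf t))).
  have /andP[up lp] := valP (nf t).
  rewrite /pwf tup_renl tlow_renl up uniq_repl //.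
  by rewrite mem_tlow_nf.
exists (nf t), (Sub _ wr); split=> //; first exact: nfK.
by apply: (key (nf t)); rewrite ?nfK.
Qed.

Lemma tmul_tdelta i j k : i != j -> j != k -> i != k ->
  tmul (tdelta T j k) (tdelta T i j) = tdelta T i k.
Proof.
move=> ij jk ik; apply/esym/is_renuP.
- by rewrite FIu_tdelta // in_fset1.
- by rewrite FIu_tdelta // in_fset1.
- by rewrite FIl_tdelta // in_fset1.
exists (wdelta T j k), (wdelta T i k); split=> //.
- by rewrite FIu_tdelta // in_fset1.
- by rewrite /= !inE negb_or ij.
- by rewrite /= /repl eqxx.
Qed.

Lemma replK i j x : i != x -> repl j i (repl i j x) = x.
Proof.
by rewrite /repl; case: (eqVneq x j) => [->|_] ix; rewrite ?eqxx // eq_sym (negPf ix).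
Qed.

Lemma repl_notin i j (l : seq Ind) : i != j -> j \notin map (repl i j) l.
Proof.
move=> ij; apply/mapP => -[x _]; rewrite /repl; case: eqVneq => [_|/eqP xj] e.
  by rewrite e eqxx in ij.
by case: xj.
Qed.

Lemma map_renuK i j (p : pterm Ind T) :
  i \notin tup p -> map (renu j i) (map (renu i j) p) = p.
Proof.
elim: p => // -[x y w|w] p IH /=; last by move/IH ->.
rewrite inE negb_or => /andP[ix /IH ->]; congr (Edge _ _ _ :: _).
by rewrite replK.
Qed.

Lemma map_renlK i j (p : pterm Ind T) :
  i \notin tlow p -> map (renl j i) (map (renl i j) p) = p.
Proof.
elim: p => // -[x y w|w] p IH /=; last by move/IH ->.
rewrite inE negb_or => /andP[ix /IH ->]; congr (Edge _ _ _ :: _).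
by rewrite replK.
Qed.

(** The representative used by the first renaming avoids [i], so mapping [i] back to [j] restores it
    literally. *)
Lemma tmul_tdeltauK i j t : j \in FIu t -> i \notin FIu t -> i \notin FIl t ->
  tmul (tmul t (tdelta T i j)) (tdelta T j i) = t.
Proof.
move=> jt iu il.
have ij : i != j by apply: contraTneq jt => <-.
have j' : j \notin FIl t.
  by apply: (fdisjointP (disj_FI t)).
have cd : compat t (tdelta T i j) by rewrite compat_tdelta ?iu ?il ?j' // eq_sym.
apply/esym/is_renuP.
- by rewrite FIu_mul // FIu_tdelta ?FIl_tdelta // 1?eq_sym // in_bprod !in_fset1 eqxx
    orbT negb_or ?il ?iu.
- by rewrite FIu_mul // FIu_tdelta ?FIl_tdelta // 1?eq_sym // in_bprod !in_fset1 eqxx ?jt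
    ?orbT ?andbF // (negPf j') eq_sym (negPf ij).
- by rewrite FIl_mul // FIu_tdelta ?FIl_tdelta // 1?eq_sym // in_bprod !in_fset1 eqxx ?jt
    ?orbT ?andbF // (negPf j') eq_sym (negPf ij).
have : is_renu i j t (tmul t (tdelta T i j)) by apply/is_renuP.
case=> a [b [ta rb _ ia ba]].
move: (ia); rewrite mem_cat negb_or => /andP[iau ial].
exists b, a; split=> //.
- by rewrite FIu_mul // FIu_tdelta ?FIl_tdelta // 1?eq_sym // in_bprod !in_fset1 eqxx
    orbT negb_or ?il ?iu.
- move: jt; rewrite -ta in_FIu_pi => /andP[_ jn].
  by rewrite ba tup_renu tlow_renu mem_cat negb_or repl_notin // jn.
- by rewrite ba; apply/esym/map_renuK.
Qed.

Lemma tmul_tdeltalK i j t : j \in FIl t -> i \notin FIu t -> i \notin FIl t ->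
  tmul (tmul t (tdelta T j i)) (tdelta T i j) = t.
Proof.
move=> jt iu il.
have ij : i != j by apply: contraTneq jt => <-.
have j' : j \notin FIu t.
  by apply: contraTN jt; apply: (fdisjointP (disj_FI t)).
have cd : compat t (tdelta T j i) by rewrite compat_tdelta ?iu ?il ?j' // eq_sym.
apply/esym/is_renlP.
- by rewrite FIl_mul // FIu_tdelta ?FIl_tdelta // 1?eq_sym // in_bprod !in_fset1 eqxx
    orbT negb_or ?il ?iu.
- by rewrite FIu_mul // FIu_tdelta ?FIl_tdelta // 1?eq_sym // in_bprod !in_fset1 eqxx ?jt
    ?orbT ?andbF // (negPf j') eq_sym (negPf ij).
- by rewrite FIl_mul // FIu_tdelta ?FIl_tdelta // 1?eq_sym // in_bprod !in_fset1 eqxx ?jt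
    ?orbT ?andbF // (negPf j') eq_sym (negPf ij).
have : is_renl i j t (tmul t (tdelta T j i)) by apply/is_renlP.
case=> a [b [ta rb _ ia ba]].
move: (ia); rewrite mem_cat negb_or => /andP[iau ial].
exists b, a; split=> //.
- by rewrite FIl_mul // FIu_tdelta ?FIl_tdelta // 1?eq_sym // in_bprod !in_fset1 eqxx
    orbT negb_or ?il ?iu.
- move: jt; rewrite -ta in_FIl_pi => /andP[_ jn].
  by rewrite ba tup_renl tlow_renl mem_cat negb_or repl_notin // jn.
- by rewrite ba; apply/esym/map_renlK.
Qed.

End Product.

(** * Deciding statements about boundaries index by index *)

Section Pointwise.
Variables (K : choiceType) (A B : {fset K}) (i j : K).

Lemma disjoint_pt : [disjoint A & B]%fset -> forall x, ~~ ((x \in A) && (x \in B)).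
Proof. by move=> /fdisjointP d x; apply/negP => /andP[/d/negP]. Qed.

Lemma eq_pt : A = B -> forall x, (x \in A) = (x \in B).
Proof. by move->. Qed.

Lemma in_pt : j \in A -> forall x, (x == j) ==> (x \in A).
Proof. by move=> jA x; apply/implyP => /eqP ->. Qed.

Lemma notin_pt : j \notin A -> forall x, (x == j) ==> (x \notin A).
Proof. by move=> jA x; apply/implyP => /eqP ->. Qed.

Lemma neq_pt : i != j -> forall x, ~~ ((x == i) && (x == j)).
Proof. by move=> ij x; apply: contraNN ij => /andP[/eqP <-]. Qed.

End Pointwise.

Definition in_fsets := (in_bprod, in_fset0, in_fset1, in_fset1U, in_fsetD1,
  in_fsetU, in_fsetD).

Ltac bool_cases :=
  rewrite /= ?andbT ?andbF ?orbT ?orbF /=;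
  try done;
  match goal with
  | |- context [?x \in ?A] => case: (x \in A); bool_cases
  | |- context [?x == ?y] => case: (x == y); bool_cases
  | |- context [has ?a ?l] => case: (has a l); bool_cases
  end.

(* Hypotheses are instantiated only at the point at which the goal is tested;
   what remains is a propositional tautology in the membership atoms. *)
Ltac fset_dec :=
  lazymatch goal with
  | |- is_true (?x \in _) => idtac
  | |- is_true (?x \notin _) => idtac
  | |- is_true (fdisjoint _ _) => apply/fdisjointP => ?
  | |- @eq _ _ _ => apply/fsetP => ?
  end;
  lazymatch goal with
  | |- context [?x \in _] =>
    repeat match goal with
    | H : is_true (fdisjoint _ _) |- _ => move: (disjoint_pt H x); clear H
    | H : @eq _ ?A ?B |- _ => move: (eq_pt H x); clear H
    | H : is_true (_ \in _) |- _ => move: (in_pt H x); clear H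
    | H : is_true (_ \notin _) |- _ => move: (notin_pt H x); clear H
    | H : is_true (_ != _) |- _ => move: (neq_pt H x); clear H
    end
  end;
  rewrite ?in_fsets ?eqxx; bool_cases.

(** * Iterated products of pairwise composable terms *)

Section IteratedProduct.
Variables (Ind T : choiceType).
Implicit Types (t : tterm Ind T) (ts ss : seq (tterm Ind T)) (x : Ind).

Definition prods ts := foldr (@tmul _ _) (tone Ind T) ts.

Lemma compat_prods t ts : all (compat t) ts -> pairwise (@compat _ _) ts ->
  compat t (prods ts).
Proof.
elim: ts t => [|s ts IH] t /=; first by rewrite compat_tone.
move=> /andP[ts_ tts] /andP[sts pts]; apply: compat_tmul => //; exact: IH.
Qed.

(** Among pairwise composable factors an index is free upper in at most one and free lower in at
    most one, so it survives exactly if it occurs on one side only. *)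
Lemma FI_prods ts x : pairwise (@compat _ _) ts ->
  (x \in FIu (prods ts)) =
    has (fun t => x \in FIu t) ts && ~~ has (fun t => x \in FIl t) ts /\
  (x \in FIl (prods ts)) =
    has (fun t => x \in FIl t) ts && ~~ has (fun t => x \in FIu t) ts.
Proof.
elim: ts => [|t ts IH] /=; first by rewrite FIu_tone FIl_tone !in_fset0.
move=> /andP[tts pts]; have [eu el] := IH pts.
rewrite FIu_mul ?FIl_mul ?compat_prods // !in_bprod eu el.
have := disjoint_pt (disj_FI t) x.
have cu : ~~ ((x \in FIu t) && has (fun t => x \in FIu t) ts).
  apply/negP => /andP[xt /hasP[s sts xs]].
  by have /andP[/fdisjointP/(_ _ xt)] := allP tts s sts; rewrite xs.
have cl : ~~ ((x \in FIl t) && has (fun t => x \in FIl t) ts).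
  apply/negP => /andP[xt /hasP[s sts xs]].
  by have /andP[_ /fdisjointP/(_ _ xt)] := allP tts s sts; rewrite xs.
by move: cu cl; bool_cases.
Qed.

Lemma prods_cat ts ss : pairwise (@compat _ _) (ts ++ ss) ->
  prods (ts ++ ss) = tmul (prods ts) (prods ss).
Proof.
elim: ts => [|t ts IH] /=.
  by move=> pss; rewrite tmulC ?tmult1 // compatC compat_tone.
rewrite all_cat => /andP[/andP[tts tss] pw]; rewrite IH // tmulA //.
- by apply: compat_prods => //; move: pw; rewrite pairwise_cat => /and3P[].
- by apply: compat_prods => //; move: pw; rewrite pairwise_cat => /and3P[].
move: pw; rewrite pairwise_cat => /and3P[/allrelP cts pts pss].
rewrite compatC; apply: compat_prods => //; apply/allP => s sts.
rewrite compatC; apply: compat_prods => //; apply/allP => r rss.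
exact: cts.
Qed.

(** Contexts are taken up to [Permutation], whereas [pairwise] reads a list in order; symmetry of
    [r] bridges the two. *)
Lemma pairwise_Permutation (S : Type) (r : rel S) (l l' : seq S) : symmetric r ->
  Permutation l l' -> pairwise r l -> pairwise r l'.
Proof.
move=> rC; have all_perm p k k' : Permutation k k' -> all p k = all p k' :> bool.
  by elim=> //= [x k1 k2 _ ->|x y k1|k1 k2 k3 _ -> _ ->] //; rewrite andbCA.
elim=> //= [x k k' kk IH /andP[xk /IH ->]|x y k|k k' k'' _ IH _ IH' /IH /IH' //].
  by rewrite -(all_perm _ _ _ _ kk) xk.
by rewrite (rC x y) => /andP[/andP[-> ->] /andP[-> ->]].
Qed.

Lemma prods_Permutation ts ss : Permutation ts ss ->
  pairwise (@compat _ _) ts -> prods ts = prods ss.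
Proof.
elim=> //= [t k k' kk IH /andP[_ /IH -> //]|t s k|k k' k'' kk IH _ IH' pk].
  move=> /andP[/andP[st sk] /andP[tk pk]].
  rewrite !tmulA ?compat_prods // 1?compatC // (tmulC st) //.
by rewrite IH // IH' //; apply: pairwise_Permutation kk pk; apply: compatC.
Qed.

Lemma is_prods_prods ts : pairwise (@compat _ _) ts -> is_prods ts (prods ts).
Proof.
elim: ts => //= t ts IH /andP[tts pts]; exists (prods ts); first exact: IH.
by apply/is_prodP; split; rewrite ?compat_prods.
Qed.

End IteratedProduct.

(** * Semantic types *)

Section SemanticTypes.
Variables (Ind T : choiceType) (D : ptype Ind T).
Local Notation tt := (tterm Ind T).
Local Notation pt := (ptype Ind T).
Local Notation dual := (pdual D).
Implicit Types (t s r : tt) (i j : Ind) (X Y : pt).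

Lemma ptype_eq X Y : pu X = pu Y -> pl X = pl Y ->
  (forall t, pset X t <-> pset Y t) -> X = Y.
Proof.
case: X Y => [u l x] [u' l' y] /= -> -> xy; congr PType.
by apply/funext => t; apply/propext.
Qed.

Lemma FI_pretype X t : is_pretype X -> pset X t -> FIu t = pu X /\ FIl t = pl X.
Proof. by case=> _; apply. Qed.

Lemma pmulP X Y r : is_pretype X -> is_pretype Y ->
  [disjoint pu X & pu Y]%fset -> [disjoint pl X & pl Y]%fset ->
  pset (pmul X Y) r <-> exists t s, [/\ pset X t, pset Y s & r = tmul t s].
Proof.
move=> pX pY du dl; split=> -[t [s [Xt Ys]]]; first by case/is_prodP; exists t, s.
move=> ->; exists t, s; split=> //; apply/is_prodP; split=> //.
have [[ut lt] [us ls]] := (FI_pretype pX Xt, FI_pretype pY Ys).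
by rewrite /compat ut lt us ls du.
Qed.

Lemma pmul_pretype X Y : is_pretype X -> is_pretype Y ->
  [disjoint pu X & pu Y]%fset -> [disjoint pl X & pl Y]%fset ->
  is_pretype (pmul X Y).
Proof.
move=> pX pY du dl; split; first by fset_dec.
move=> r /pmulP[] // t [s [Xt Ys ->]].
have [[ut lt] [us ls]] := (FI_pretype pX Xt, FI_pretype pY Ys).
by rewrite FIu_mul ?FIl_mul /compat ut lt us ls ?du.
Qed.

Lemma pmulC X Y : is_pretype X -> is_pretype Y ->
  [disjoint pu X & pu Y]%fset -> [disjoint pl X & pl Y]%fset ->
  pmul X Y = pmul Y X.
Proof.
move=> pX pY du dl; have du' := du; have dl' := dl.
rewrite fdisjoint_sym in du'; rewrite fdisjoint_sym in dl'.
have cXY t s : pset X t -> pset Y s -> compat t s.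
  move=> /(FI_pretype pX)[ut lt] /(FI_pretype pY)[us ls].
  by rewrite /compat ut lt us ls du.
apply: ptype_eq => [||r]; [by fset_dec|by fset_dec|].
split=> /pmulP[] // t [s [tt_ ss ->]]; apply/pmulP => //; exists s, t; split=> //;
  by apply: tmulC; first [exact: cXY | rewrite compatC; exact: cXY].
Qed.

(** Elements of [X] and of its dual have opposite boundaries, and the two halves of the boundary of
    [X] are disjoint, so the product required by the dual is always defined. *)
Lemma pdualP X s : is_pretype X -> pset (dual X) s <->
  [/\ FIu s = pl X, FIl s = pu X & forall t, pset X t -> pset D (tmul t s)].
Proof.
move=> pX; split=> -[us ls Ds]; split=> // t Xt.
  by have [r /is_prodP[_ ->]] := Ds t Xt.
exists (tmul t s); last exact: Ds.
have [ut lt] := FI_pretype pX Xt; apply/is_prodP; split=> //.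
by rewrite /compat ut lt us ls (fdisjoint_sym (pl X)) pX.1.
Qed.

Lemma pdual_pretype X : is_pretype X -> is_pretype (dual X).
Proof. by move=> pX; split=> [|t []] //; rewrite fdisjoint_sym pX.1. Qed.

Lemma compat_dual X t s : is_pretype X -> pset X t ->
  FIu s = pl X -> FIl s = pu X -> compat t s.
Proof.
move=> pX /(FI_pretype pX)[ut lt] us ls.
by rewrite /compat ut lt us ls (fdisjoint_sym (pl X)) pX.1.
Qed.

Lemma sub_bidual X t : is_pretype X -> pset X t -> pset (dual (dual X)) t.
Proof.
move=> pX Xt; have [ut lt] := FI_pretype pX Xt.
apply/pdualP; first exact: pdual_pretype.
split=> // s /pdualP[] // us ls Ds; rewrite -tmulC; first exact: Ds.
exact: compat_dual Xt us ls.
Qed.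

(** The usual Galois argument: a pretype is contained in its bidual, and taking duals reverses
    inclusions. *)
Lemma tridual X : is_pretype X -> dual (dual (dual X)) = dual X.
Proof.
move=> pX; have pd := pdual_pretype pX; have pdd := pdual_pretype pd.
apply: ptype_eq => // s; split=> [/pdualP[] // us ls Ds|]; last exact: sub_bidual.
by apply/pdualP => //; split=> // t Xt; apply: Ds; apply: sub_bidual.
Qed.

Lemma pdual_type X : is_pretype X -> is_type D (dual X).
Proof. by move=> pX; split; rewrite ?tridual //; apply: pdual_pretype. Qed.

Lemma ptensor_type X Y : is_pretype X -> is_pretype Y ->
  [disjoint pu X & pu Y]%fset -> [disjoint pl X & pl Y]%fset ->
  is_type D (ptensor D X Y).
Proof. by move=> *; apply/pdual_type/pdual_pretype/pmul_pretype. Qed.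

Lemma ppar_type X Y : is_pretype X -> is_pretype Y ->
  [disjoint pu X & pu Y]%fset -> [disjoint pl X & pl Y]%fset ->
  is_type D (ppar D X Y).
Proof. by move=> *; apply/pdual_type/pmul_pretype => //; apply: pdual_pretype. Qed.

(** On the left a triple dual collapses; on the right the biduals of [X] and [Y] do, as both are
    types. *)
Lemma dual_ptensor X Y : is_type D X -> is_type D Y ->
  [disjoint pu X & pu Y]%fset -> [disjoint pl X & pl Y]%fset ->
  dual (ptensor D X Y) = ppar D (dual Y) (dual X).
Proof.
move=> [pX eX] [pY eY] du dl.
rewrite /ptensor tridual; last exact: pmul_pretype.
by rewrite /ppar -eX -eY pmulC.
Qed.

Lemma dual_ppar X Y : is_pretype X -> is_pretype Y ->
  [disjoint pu X & pu Y]%fset -> [disjoint pl X & pl Y]%fset ->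
  dual (ppar D X Y) = ptensor D (dual Y) (dual X).
Proof.
by move=> pX pY du dl; rewrite /ppar /ptensor pmulC //; apply: pdual_pretype.
Qed.

(** For s in X and q in the dual of Y, reassociation turns q(st) into (sq)t. Since Y is a bidual,
    membership of ts in Y is tested by such q, and the tests together say that t is dual to the
    product of X and the dual of Y. *)
Lemma plolli_ppar X Y : is_type D X -> is_type D Y ->
  [disjoint pu X & pl Y]%fset -> [disjoint pl X & pu Y]%fset ->
  plolli X Y = ppar D (dual X) Y.
Proof.
move=> [pX eX] [pY eY] du dl.
have pdX := pdual_pretype pX; have pdY := pdual_pretype pY.
have pXY : is_pretype (pmul X (dual Y)) by apply: pmul_pretype.
rewrite /ppar -eX; apply: ptype_eq => // t.
have key s q : FIu t = pu (plolli X Y) -> FIl t = pl (plolli X Y) ->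
    pset X s -> pset (dual Y) q ->
    compat s t /\ tmul q (tmul s t) = tmul (tmul s q) t.
  move=> ut lt /(FI_pretype pX)[us ls] /(FI_pretype pdY)[uq lq].
  have sq : compat s q by rewrite /compat us ls uq lq du.
  have [[dX _] [dY _]] := (pX, pY).
  have qt : compat q t.
    by rewrite /compat ut lt uq lq /=; apply/andP; split; clear -dX dY du dl; fset_dec.
  have st : compat s t.
    by rewrite /compat ut lt us ls /=; apply/andP; split; clear -dX dY du dl; fset_dec.
  by split; rewrite // (tmulC sq) tmulA // compatC.
split=> [[ut lt Yt]|/pdualP[] // ut lt Dt].
  apply/pdualP => //; split=> // _ /pmulP[] // s [q [Xs Yq ->]].
  have [st <-] := key s q ut lt Xs Yq; rewrite (tmulC st).
  have [_ /is_prodP[_ ->]] := Yt s Xs; rewrite eY => /pdualP[] // _ _; exact.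
split=> // s Xs.
have [us ls] := FI_pretype pX Xs.
have [[dX _] [dY _]] := (pX, pY).
have ts : compat t s.
  by rewrite /compat ut lt us ls /=; apply/andP; split; clear -dX dY du dl; fset_dec.
exists (tmul t s); first exact/is_prodP.
rewrite eY; apply/pdualP => //; split.
- by rewrite FIu_mul // ut lt us ls /=; clear -dX dY du dl; fset_dec.
- by rewrite FIl_mul // ut lt us ls /=; clear -dX dY du dl; fset_dec.
move=> q Yq; have [_ e] := key s q ut lt Xs Yq.
by rewrite (tmulC ts) e; apply: Dt; apply/pmulP => //; exists s, q.
Qed.

(** * Renaming of indices in semantic types *)

Section Renaming.
Variables (i j : Ind) (X : pt).
Hypotheses (pX : is_pretype X) (iu : i \notin pu X) (il : i \notin pl X).

Lemma prenuP r : j \in pu X ->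
  pset (prenu i j X) r <-> exists2 t, pset X t & r = tmul t (tdelta T i j).
Proof.
by move=> ju; split=> -[t Xt rt]; exists t => //; have [ut lt] := FI_pretype pX Xt;
  apply/is_renuP; rewrite ?ut ?lt.
Qed.

Lemma prenlP r : j \in pl X ->
  pset (prenl i j X) r <-> exists2 t, pset X t & r = tmul t (tdelta T j i).
Proof.
by move=> jl; split=> -[t Xt rt]; exists t => //; have [ut lt] := FI_pretype pX Xt;
  apply/is_renlP; rewrite ?ut ?lt.
Qed.

Lemma prenu_pretype : j \in pu X -> is_pretype (prenu i j X).
Proof.
move=> ju; have dX := pX.1.
have ij : i != j by apply: contraTneq ju => <-.
split=> [|r /prenuP[] // t Xt ->]; first by fset_dec.
have [ut lt] := FI_pretype pX Xt.
have jl : j \notin pl X by apply: (fdisjointP dX).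
have cd : compat t (tdelta T i j) by rewrite compat_tdelta // ut lt iu.
rewrite FIu_mul // FIl_mul // ut lt FIu_tdelta // FIl_tdelta // /=.
by split; clear ut lt; fset_dec.
Qed.

Lemma prenl_pretype : j \in pl X -> is_pretype (prenl i j X).
Proof.
move=> jl; have dX := pX.1.
have ij : i != j by apply: contraTneq jl => <-.
split=> [|r /prenlP[] // t Xt ->]; first by fset_dec.
have [ut lt] := FI_pretype pX Xt.
have ju : j \notin pu X.
  by apply: contraTN jl; apply: (fdisjointP dX).
have cd : compat t (tdelta T j i) by rewrite compat_tdelta 1?eq_sym // ut lt il ju.
rewrite FIu_mul // FIl_mul // ut lt FIu_tdelta 1?eq_sym // FIl_tdelta 1?eq_sym //=.
by split; clear ut lt; fset_dec.
Qed.

End Renaming.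

(** The delta moves across the pairing, (t delta) r = t (r delta); on the dual side the same delta
    undoes the renaming, turning the lower index [i] into [j]. *)
Lemma pdual_prenu i j X : is_pretype X ->
  j \in pu X -> i \notin pu X -> i \notin pl X ->
  dual (prenu i j X) = prenl i j (dual X).
Proof.
move=> pX jX iu il; have pr := prenu_pretype pX iu il jX.
have pd := pdual_pretype pX; have dX := pX.1.
have ij : i != j by apply: contraTneq jX => <-.
have ji : j != i by rewrite eq_sym.
have j' : j \notin pl X by clear -dX jX; fset_dec.
have key t r : pset X t -> FIu r = pl (prenu i j X) -> FIl r = pu (prenu i j X) ->
    tmul (tmul t (tdelta T i j)) r = tmul t (tmul r (tdelta T i j)).
  move=> /(FI_pretype pX)[ut lt] ur lr.
  have td : compat t (tdelta T i j).
    by rewrite compat_tdelta // ut lt ?iu ?il ?j'.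
  have rd : compat r (tdelta T i j).
    by rewrite compat_tdelta // ur lr /=; apply/andP; split;
      clear -ij dX iu il jX; fset_dec.
  have tr : compat t r.
    by rewrite /compat ut lt ur lr /=; apply/andP; split;
      clear -ij dX iu il jX; fset_dec.
  by rewrite -tmulA // 1?compatC // (tmulC rd).
have FIr r : FIu r = pl (prenu i j X) -> FIl r = pu (prenu i j X) ->
    [/\ i \in FIl r, i \notin FIu r, j \notin FIu r & j \notin FIl r].
  by move=> -> ->; split; clear -ij dX iu il jX; fset_dec.
apply: ptype_eq => // r; split=> [/pdualP[] // ur lr Dr|].
  have [ir ir' ju jl] := FIr r ur lr.
  (* The witness is [r] with its lower index [i] renamed back to [j]. *)
  apply/prenlP => //; exists (tmul r (tdelta T i j)); last by rewrite tmul_tdeltalK.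
  have rd : compat r (tdelta T i j) by rewrite compat_tdelta // ?ju ?jl ?ir'.
  apply/pdualP => //; split.
  - by rewrite FIu_mul // FIu_tdelta 1?FIl_tdelta // ur lr;
      clear -ij dX iu il jX; fset_dec.
  - by rewrite FIl_mul // FIu_tdelta 1?FIl_tdelta // ur lr;
      clear -ij dX iu il jX; fset_dec.
  - by move=> t Xt; rewrite -key //; apply: Dr; apply/prenuP => //; exists t.
move=> dr; have [] := FI_pretype (prenl_pretype pd il iu jX) dr => ur lr.
apply/pdualP => //; split=> // _ /prenuP[] // t Xt ->; rewrite key //.
move: dr => /prenlP[] // s /pdualP[] // us ls Ds ->.
by rewrite tmul_tdeltalK ?us ?ls //; apply: Ds.
Qed.

Lemma pdual_prenl i j X : is_pretype X ->
  j \in pl X -> i \notin pu X -> i \notin pl X ->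
  dual (prenl i j X) = prenu i j (dual X).
Proof.
move=> pX jX iu il; have pr := prenl_pretype pX iu il jX.
have pd := pdual_pretype pX; have dX := pX.1.
have ij : i != j by apply: contraTneq jX => <-.
have ji : j != i by rewrite eq_sym.
have j' : j \notin pu X by clear -dX jX; fset_dec.
have key t r : pset X t -> FIu r = pl (prenl i j X) -> FIl r = pu (prenl i j X) ->
    tmul (tmul t (tdelta T j i)) r = tmul t (tmul r (tdelta T j i)).
  move=> /(FI_pretype pX)[ut lt] ur lr.
  have td : compat t (tdelta T j i).
    by rewrite compat_tdelta // ut lt ?iu ?il ?j'.
  have rd : compat r (tdelta T j i).
    by rewrite compat_tdelta // ur lr /=; apply/andP; split;
      clear -ij dX iu il jX; fset_dec.
  have tr : compat t r.
    by rewrite /compat ut lt ur lr /=; apply/andP; split;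
      clear -ij dX iu il jX; fset_dec.
  by rewrite -tmulA // 1?compatC // (tmulC rd).
have FIr r : FIu r = pl (prenl i j X) -> FIl r = pu (prenl i j X) ->
    [/\ i \in FIu r, i \notin FIl r, j \notin FIu r & j \notin FIl r].
  by move=> -> ->; split; clear -ij dX iu il jX; fset_dec.
apply: ptype_eq => // r; split=> [/pdualP[] // ur lr Dr|].
  have [ir ir' ju jl] := FIr r ur lr.
  apply/prenuP => //; exists (tmul r (tdelta T j i)); last by rewrite tmul_tdeltauK.
  have rd : compat r (tdelta T j i) by rewrite compat_tdelta // ?ju ?jl ?ir'.
  apply/pdualP => //; split.
  - by rewrite FIu_mul // FIu_tdelta 1?FIl_tdelta // ur lr;
      clear -ij dX iu il jX; fset_dec.
  - by rewrite FIl_mul // FIu_tdelta 1?FIl_tdelta // ur lr;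
      clear -ij dX iu il jX; fset_dec.
  - by move=> t Xt; rewrite -key //; apply: Dr; apply/prenlP => //; exists t.
move=> dr; have [] := FI_pretype (prenu_pretype pd il iu jX) dr => ur lr.
apply/pdualP => //; split=> // _ /prenlP[] // t Xt ->; rewrite key //.
move: dr => /prenuP[] // s /pdualP[] // us ls Ds ->.
by rewrite tmul_tdeltauK ?us ?ls //; apply: Ds.
Qed.

(** As [j] is not a lower index of [Y], it stays free in the product, and its delta can be moved
    past the factor from [Y]. *)
Lemma prenu_pmul i j X Y : is_pretype X -> is_pretype Y ->
  [disjoint pu X & pu Y]%fset -> [disjoint pl X & pl Y]%fset ->
  j \in pu X -> j \notin pl Y ->
  i \notin pu X -> i \notin pl X -> i \notin pu Y -> i \notin pl Y ->
  prenu i j (pmul X Y) = pmul (prenu i j X) Y.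
Proof.
move=> pX pY du dl jX jY iuX ilX iuY ilY.
have [[dX _] [dY _]] := (pX, pY).
have pr := prenu_pretype pX iuX ilX jX; have pXY := pmul_pretype pX pY du dl.
have ij : i != j by apply: contraTneq jX => <-.
have ji : j != i by rewrite eq_sym.
have key t s : pset X t -> pset Y s ->
    tmul (tmul t s) (tdelta T i j) = tmul (tmul t (tdelta T i j)) s.
  move=> /(FI_pretype pX)[ut lt] /(FI_pretype pY)[us ls].
  have sd : compat s (tdelta T i j).
    rewrite compat_tdelta // us ls; apply/andP; split;
      clear -ij dX dY du dl jX jY iuX ilX iuY ilY; fset_dec.
  have td : compat t (tdelta T i j).
    rewrite compat_tdelta // ut lt; apply/andP; split;
      clear -ij dX dY du dl jX jY iuX ilX iuY ilY; fset_dec.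
  have ts : compat t s by rewrite /compat ut lt us ls du.
  by rewrite -tmulA // (tmulC sd) tmulA // compatC.
have [ju iu il] : [/\ j \in pu (pmul X Y), i \notin pu (pmul X Y)
    & i \notin pl (pmul X Y)].
  by split; clear -ij dX dY du dl jX jY iuX ilX iuY ilY; fset_dec.
apply: ptype_eq => [||r].
- by clear -ij dX dY du dl jX jY iuX ilX iuY ilY; fset_dec.
- by clear -ij dX dY du dl jX jY iuX ilX iuY ilY; fset_dec.
have dr : [disjoint pu (prenu i j X) & pu Y]%fset.
  by clear -ij dX dY du dl jX jY iuX ilX iuY ilY; fset_dec.
have dr' : [disjoint pl (prenu i j X) & pl Y]%fset.
  by clear -ij dX dY du dl jX jY iuX ilX iuY ilY; fset_dec.
split=> [/prenuP[] // _ /pmulP[] // t [s [Xt Ys ->]] ->|].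
  apply/pmulP => //; exists (tmul t (tdelta T i j)), s.
  by split; rewrite ?key //; apply/prenuP => //; exists t.
move=> /pmulP[] // _ [s [/prenuP[] // t Xt -> Ys ->]].
apply/prenuP => //; exists (tmul t s); last by rewrite key.
by apply/pmulP => //; exists t, s.
Qed.

Lemma prenl_pmul i j X Y : is_pretype X -> is_pretype Y ->
  [disjoint pu X & pu Y]%fset -> [disjoint pl X & pl Y]%fset ->
  j \in pl X -> j \notin pu Y ->
  i \notin pu X -> i \notin pl X -> i \notin pu Y -> i \notin pl Y ->
  prenl i j (pmul X Y) = pmul (prenl i j X) Y.
Proof.
move=> pX pY du dl jX jY iuX ilX iuY ilY.
have [[dX _] [dY _]] := (pX, pY).
have pr := prenl_pretype pX iuX ilX jX; have pXY := pmul_pretype pX pY du dl.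
have ij : i != j by apply: contraTneq jX => <-.
have ji : j != i by rewrite eq_sym.
have key t s : pset X t -> pset Y s ->
    tmul (tmul t s) (tdelta T j i) = tmul (tmul t (tdelta T j i)) s.
  move=> /(FI_pretype pX)[ut lt] /(FI_pretype pY)[us ls].
  have sd : compat s (tdelta T j i).
    rewrite compat_tdelta // us ls; apply/andP; split;
      clear -ij dX dY du dl jX jY iuX ilX iuY ilY; fset_dec.
  have td : compat t (tdelta T j i).
    rewrite compat_tdelta // ut lt; apply/andP; split;
      clear -ij dX dY du dl jX jY iuX ilX iuY ilY; fset_dec.
  have ts : compat t s by rewrite /compat ut lt us ls du.
  by rewrite -tmulA // (tmulC sd) tmulA // compatC.
have [ju iu il] : [/\ j \in pl (pmul X Y), i \notin pu (pmul X Y)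
    & i \notin pl (pmul X Y)].
  by split; clear -ij dX dY du dl jX jY iuX ilX iuY ilY; fset_dec.
apply: ptype_eq => [||r].
- by clear -ij dX dY du dl jX jY iuX ilX iuY ilY; fset_dec.
- by clear -ij dX dY du dl jX jY iuX ilX iuY ilY; fset_dec.
have dr : [disjoint pu (prenl i j X) & pu Y]%fset.
  by clear -ij dX dY du dl jX jY iuX ilX iuY ilY; fset_dec.
have dr' : [disjoint pl (prenl i j X) & pl Y]%fset.
  by clear -ij dX dY du dl jX jY iuX ilX iuY ilY; fset_dec.
split=> [/prenlP[] // _ /pmulP[] // t [s [Xt Ys ->]] ->|].
  apply/pmulP => //; exists (tmul t (tdelta T j i)), s.
  by split; rewrite ?key //; apply/prenlP => //; exists t.
move=> /pmulP[] // _ [s [/prenlP[] // t Xt -> Ys ->]].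
apply/prenlP => //; exists (tmul t s); last by rewrite key.
by apply/pmulP => //; exists t, s.
Qed.

(** The renaming crosses two duals, each exchanging upper and lower, and so reaches the product as
    an upper renaming again. *)
Lemma prenu_ptensorl i j X Y : is_pretype X -> is_pretype Y ->
  [disjoint pu X & pu Y]%fset -> [disjoint pl X & pl Y]%fset ->
  j \in pu X -> j \notin pl Y ->
  i \notin pu X -> i \notin pl X -> i \notin pu Y -> i \notin pl Y ->
  prenu i j (ptensor D X Y) = ptensor D (prenu i j X) Y.
Proof.
move=> pX pY du dl jX jY iuX ilX iuY ilY; have [[dX _] [dY _]] := (pX, pY).
have [ju iu il] : [/\ j \in pu (pmul X Y), i \notin pu (pmul X Y)
    & i \notin pl (pmul X Y)].
  by split; clear -dX dY du dl jX jY iuX ilX iuY ilY; fset_dec.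
have pXY := pmul_pretype pX pY du dl; have pd := pdual_pretype pXY.
by rewrite /ptensor -pdual_prenl // -pdual_prenu // prenu_pmul.
Qed.

(** The outer dual turns the upper renaming into a lower one of the product, and the dual of [X]
    turns it back. *)
Lemma prenu_pparl i j X Y : is_pretype X -> is_pretype Y ->
  [disjoint pu X & pu Y]%fset -> [disjoint pl X & pl Y]%fset ->
  j \in pu X -> j \notin pl Y ->
  i \notin pu X -> i \notin pl X -> i \notin pu Y -> i \notin pl Y ->
  prenu i j (ppar D X Y) = ppar D (prenu i j X) Y.
Proof.
move=> pX pY du dl jX jY iuX ilX iuY ilY; have [[dX _] [dY _]] := (pX, pY).
have [pdX pdY] := (pdual_pretype pX, pdual_pretype pY).
have [ju iu il] : [/\ j \in pl (pmul (dual X) (dual Y)),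
    i \notin pu (pmul (dual X) (dual Y)) & i \notin pl (pmul (dual X) (dual Y))].
  by split; clear -dX dY du dl jX jY iuX ilX iuY ilY; fset_dec.
have pXY := pmul_pretype pdX pdY dl du.
by rewrite /ppar -pdual_prenl // prenl_pmul // pdual_prenu.
Qed.

Lemma prenl_ptensorl i j X Y : is_pretype X -> is_pretype Y ->
  [disjoint pu X & pu Y]%fset -> [disjoint pl X & pl Y]%fset ->
  j \in pl X -> j \notin pu Y ->
  i \notin pu X -> i \notin pl X -> i \notin pu Y -> i \notin pl Y ->
  prenl i j (ptensor D X Y) = ptensor D (prenl i j X) Y.
Proof.
move=> pX pY du dl jX jY iuX ilX iuY ilY; have [[dX _] [dY _]] := (pX, pY).
have [ju iu il] : [/\ j \in pl (pmul X Y), i \notin pu (pmul X Y)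
    & i \notin pl (pmul X Y)].
  by split; clear -dX dY du dl jX jY iuX ilX iuY ilY; fset_dec.
have pXY := pmul_pretype pX pY du dl; have pd := pdual_pretype pXY.
by rewrite /ptensor -pdual_prenu // -pdual_prenl // prenl_pmul.
Qed.

Lemma prenl_pparl i j X Y : is_pretype X -> is_pretype Y ->
  [disjoint pu X & pu Y]%fset -> [disjoint pl X & pl Y]%fset ->
  j \in pl X -> j \notin pu Y ->
  i \notin pu X -> i \notin pl X -> i \notin pu Y -> i \notin pl Y ->
  prenl i j (ppar D X Y) = ppar D (prenl i j X) Y.
Proof.
move=> pX pY du dl jX jY iuX ilX iuY ilY; have [[dX _] [dY _]] := (pX, pY).
have [pdX pdY] := (pdual_pretype pX, pdual_pretype pY).
have [ju iu il] : [/\ j \in pu (pmul (dual X) (dual Y)),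
    i \notin pu (pmul (dual X) (dual Y)) & i \notin pl (pmul (dual X) (dual Y))].
  by split; clear -dX dY du dl jX jY iuX ilX iuY ilY; fset_dec.
have pXY := pmul_pretype pdX pdY dl du.
by rewrite /ppar -pdual_prenu // prenu_pmul // pdual_prenl.
Qed.

Lemma ptensorC X Y : is_pretype X -> is_pretype Y ->
  [disjoint pu X & pu Y]%fset -> [disjoint pl X & pl Y]%fset ->
  ptensor D X Y = ptensor D Y X.
Proof. by move=> *; rewrite /ptensor pmulC. Qed.

Lemma pparC X Y : is_pretype X -> is_pretype Y ->
  [disjoint pu X & pu Y]%fset -> [disjoint pl X & pl Y]%fset ->
  ppar D X Y = ppar D Y X.
Proof. by move=> *; rewrite /ppar pmulC //; apply: pdual_pretype. Qed.

Lemma pdelta_pretype i j : i != j -> is_pretype (pdelta T i j).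
Proof.
move=> ij; split=> [|_ ->]; first by fset_dec.
by rewrite FIu_tdelta // FIl_tdelta.
Qed.

Lemma prenu_pdelta i j k : i != j -> j != k -> i != k ->
  prenu i j (pdelta T j k) = pdelta T i k.
Proof.
move=> ij jk ik; apply: ptype_eq => [||r] //; first by fset_dec.
have pd := pdelta_pretype jk.
have [iu il ju] : [/\ i \notin pu (pdelta T j k), i \notin pl (pdelta T j k)
    & j \in pu (pdelta T j k)] by split; clear -ij jk ik; fset_dec.
split=> [/prenuP[] // _ -> ->|->]; first by rewrite tmul_tdelta.
by apply/prenuP => //; exists (tdelta T j k); rewrite ?tmul_tdelta.
Qed.

Lemma prenl_pdelta i j k : i != j -> j != k -> i != k ->
  prenl i j (pdelta T k j) = pdelta T k i.
Proof.
move=> ij jk ik; apply: ptype_eq => [||r] //; first by fset_dec.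
have [ji kj ki] : [/\ j != i, k != j & k != i] by rewrite (eq_sym j) !(eq_sym k).
have pd := pdelta_pretype kj.
have [iu il jl] : [/\ i \notin pu (pdelta T k j), i \notin pl (pdelta T k j)
    & j \in pl (pdelta T k j)] by split; clear -ij jk ik; fset_dec.
have e : tmul (tdelta T k j) (tdelta T j i) = tdelta T k i.
  rewrite tmulC ?tmul_tdelta // compat_tdelta // FIu_tdelta // FIl_tdelta //.
  by rewrite !in_fset1 jk.
split=> [/prenlP[] // _ -> ->|->]; first by rewrite e.
by apply/prenlP => //; exists (tdelta T k j); rewrite ?e.
Qed.

End SemanticTypes.

(** * Classical formulas and soundness of TTL *)

Section Formulas.
Variables (Ind : choiceType) (Lit : Type) (v : Lit -> nat * nat).
Local Notation form := (cform Ind Lit).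
Implicit Types (A B : form) (G : seq form) (i j x : Ind).

Lemma in_cFIu A x : cwf v A -> (x \in cFIu A) = (x \in cup A) && (x \notin clow A).
Proof. by case/and3P=> _ u _; rewrite /cFIu in_once. Qed.

Lemma in_cFIl A x : cwf v A -> (x \in cFIl A) = (x \in clow A) && (x \notin cup A).
Proof. by case/and3P=> _ _ u; rewrite /cFIl in_once. Qed.

(** Bound occurrences are included, so this is stronger than disjointness of free indices; it is
    what well-formedness of a compound formula gives for its components. *)
Definition separated A B : Prop :=
  forall x, ~~ ((x \in cup A) && (x \in cup B)) /\
            ~~ ((x \in clow A) && (x \in clow B)).

Lemma cwf_tensP A B : cwf v (CTens A B) -> [/\ cwf v A, cwf v B & separated A B].
Proof.
case/and3P=> /= /andP[wA wB]; rewrite !cat_uniq.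
move=> /and3P[uA /hasPn uAB uB] /and3P[lA /hasPn lAB lB].
rewrite /cwf wA wB uA uB lA lB; split=> // x.
by split; apply/negP => /andP[xA xB]; [move: (uAB x xB)|move: (lAB x xB)];
  rewrite /= xA.
Qed.

(** Holds by conversion: index lists and well-formedness do not distinguish the two connectives. *)
Lemma cwf_parP A B : cwf v (CPar A B) -> [/\ cwf v A, cwf v B & separated A B].
Proof. exact: (@cwf_tensP A B). Qed.

Lemma separated_FI A B : cwf v A -> cwf v B -> separated A B ->
  [disjoint cFIu A & cFIu B]%fset /\ [disjoint cFIl A & cFIl B]%fset.
Proof.
move=> wA wB AB; split; apply/fdisjointP => x;
  rewrite ?(in_cFIu _ wA) ?(in_cFIu _ wB) ?(in_cFIl _ wA) ?(in_cFIl _ wB);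
  have [] := AB x; bool_cases.
Qed.

Lemma cFI_tens A B : cwf v (CTens A B) ->
  cFIu (CTens A B) = bprod (cFIu A) (cFIu B) (cFIl A) (cFIl B) /\
  cFIl (CTens A B) = bprod (cFIl A) (cFIl B) (cFIu A) (cFIu B).
Proof.
move=> w; have [wA wB AB] := cwf_tensP w.
split; apply/fsetP => x; rewrite in_bprod ?(in_cFIu _ w) ?(in_cFIl _ w)
    !(in_cFIu _ wA) !(in_cFIu _ wB) !(in_cFIl _ wA) !(in_cFIl _ wB) /= !mem_cat;
  have [] := AB x; bool_cases.
Qed.

Lemma cFI_par A B : cwf v (CPar A B) ->
  cFIu (CPar A B) = bprod (cFIu A) (cFIu B) (cFIl A) (cFIl B) /\
  cFIl (CPar A B) = bprod (cFIl A) (cFIl B) (cFIu A) (cFIu B).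
Proof. exact: (@cFI_tens A B). Qed.

(** Equality holds only up to permutation, as the dual reverses index lists and swaps the components
    of a connective. *)
Lemma perm_cdual A :
  perm_eq (cup (cdual A)) (clow A) /\ perm_eq (clow (cdual A)) (cup A).
Proof.
elim: A => //= [p us ls|A [uA lA] B [uB lB]|A [uA lA] B [uB lB]].
- by rewrite !(permPl (permEl (perm_rev _))).
- by split; rewrite perm_catC; apply: perm_cat.
- by split; rewrite perm_catC; apply: perm_cat.
Qed.

Lemma once_perm (K : choiceType) (u u' l l' : seq K) :
  perm_eq u u' -> perm_eq l l' -> once u l = once u' l'.
Proof.
move=> uu ll; apply/fsetP => x; rewrite !inE /= (perm_mem uu).
by rewrite (permP (perm_cat uu ll)).
Qed.

Lemma cFIu_dual A : cFIu (cdual A) = cFIl A.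
Proof. by have [uA lA] := perm_cdual A; apply: once_perm. Qed.

Lemma cFIl_dual A : cFIl (cdual A) = cFIu A.
Proof. by have [uA lA] := perm_cdual A; apply: once_perm. Qed.

Lemma catoms_wf_dual A : catoms_wf v (cdual A) = catoms_wf v A.
Proof.
elim: A => /= [p us ls|i j|i j|A -> B ->|A -> B ->];
  [|by rewrite eq_sym|by rewrite eq_sym|by rewrite andbC|by rewrite andbC].
rewrite !size_rev -rev_cat rev_uniq !andbA; congr (_ && _).
by case: p => p /=; rewrite andbC.
Qed.

Lemma cwf_dual A : cwf v (cdual A) = cwf v A.
Proof.
have [uA lA] := perm_cdual A.
rewrite /cwf catoms_wf_dual (perm_uniq uA) (perm_uniq lA).
by rewrite [uniq (clow A) && _]andbC.
Qed.

Lemma cdualK : involutive (@cdual Ind Lit).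
Proof. by elim=> //= [[p|p] us ls|A -> B ->|A -> B ->]; rewrite ?revK. Qed.

Lemma map_repl_id i j (l : seq Ind) : j \notin l -> map (repl i j) l = l.
Proof.
move=> jl; rewrite -[RHS]map_id; apply/eq_in_map => x xl; rewrite /repl.
by case: eqVneq => // e; rewrite -e xl in jl.
Qed.

Lemma csubu_id i j A : j \notin cup A -> csubu i j A = A.
Proof.
elim: A => /= [p us ls|x y|x y|A IA B IB|A IA B IB].
- by move/map_repl_id ->.
- by rewrite inE /repl eq_sym => /negPf ->.
- by rewrite inE /repl eq_sym => /negPf ->.
- by rewrite mem_cat negb_or => /andP[/IA -> /IB ->].
- by rewrite mem_cat negb_or => /andP[/IA -> /IB ->].
Qed.

Lemma csubl_id i j A : j \notin clow A -> csubl i j A = A.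
Proof.
elim: A => /= [p us ls|x y|x y|A IA B IB|A IA B IB].
- by move/map_repl_id ->.
- by rewrite inE /repl eq_sym => /negPf ->.
- by rewrite inE /repl eq_sym => /negPf ->.
- by rewrite mem_cat negb_or => /andP[/IA -> /IB ->].
- by rewrite mem_cat negb_or => /andP[/IA -> /IB ->].
Qed.

Lemma csubu_dual i j A : csubu i j (cdual A) = cdual (csubl i j A).
Proof. by elim: A => //= [p us ls|A -> B ->|A -> B ->] //; rewrite map_rev. Qed.

Lemma csubl_dual i j A : csubl i j (cdual A) = cdual (csubu i j A).
Proof. by elim: A => //= [p us ls|A -> B ->|A -> B ->] //; rewrite map_rev. Qed.

Lemma cup_csubu i j A : cup (csubu i j A) = map (repl i j) (cup A).
Proof. by elim: A => //= A -> B ->; rewrite map_cat. Qed.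

(** If [i] were listed too, [i] and [j] would both be sent to [i]. *)
Lemma uniq_map_repl i j (l : seq Ind) : j \in l -> uniq (map (repl i j) l) ->
  i != j -> i \notin l.
Proof.
move=> jl ul ij; apply/negP => il; move: ul.
have jl' := perm_to_rem jl; rewrite (perm_uniq (perm_map (repl i j) jl')) /=.
move: il; rewrite (perm_mem jl') inE (negPf ij) /= => il.
by rewrite {1}/repl eqxx => /andP[/mapP[]]; exists i; rewrite // /repl (negPf ij).
Qed.

(** The side condition of the rules only says that [i] is not free. A bound [i] would have an upper
    occurrence, and the substitution would produce a second one, against well-formedness of the
    result. *)
Lemma csubu_fresh i j A : cwf v A -> cwf v (csubu i j A) ->
  j \in cFIu A -> i \notin cFIu A -> i \notin cFIl A ->
  i \notin cup A /\ i \notin clow A.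
Proof.
move=> wA /and3P[_ uA' _] jA iu il.
have ij : i != j by apply: contraTneq jA => <-.
have iA : i \notin cup A.
  apply: (uniq_map_repl (j := j)) => //; last by rewrite -cup_csubu.
  by move: jA; rewrite (in_cFIu _ wA) => /andP[].
by split=> //; move: il; rewrite (in_cFIl _ wA) iA andbT.
Qed.

Lemma csubl_fresh i j A : cwf v A -> cwf v (csubl i j A) ->
  j \in cFIl A -> i \notin cFIu A -> i \notin cFIl A ->
  i \notin cup A /\ i \notin clow A.
Proof.
move=> wA wA'; rewrite -cFIu_dual -[cFIu A]cFIl_dual => jA il iu.
have [] := @csubu_fresh i j (cdual A); rewrite ?cwf_dual ?csubu_dual ?cwf_dual //.
by have [p q] := perm_cdual A; rewrite (perm_mem p) (perm_mem q).
Qed.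

(** * Interpretation of classical formulas: boundaries, duality, substitution *)

Section Interpretation.
Variable M : model Ind v.
Local Notation D := (dualizing (msys M)).
Local Notation dual := (pdual D).

(** Boundaries and the type property need one joint induction: tensor and cotensor products of types
    are types when the boundaries are disjoint, which is read off the formulas. *)
Lemma cinterp_type A : cwf v A ->
  [/\ is_type D (cinterp M A), pu (cinterp M A) = cFIu A
    & pl (cinterp M A) = cFIl A].
Proof.
elim: A => [p us ls|i j|i j|A IA B IB|A IA B IB] w.
- have /and3P[/and3P[s1 s2 u12] _ _] := w.
  have [dus dls] : cFIu (CAtom p us ls) = [fset x in us]%fset /\
      cFIl (CAtom p us ls) = [fset x in ls]%fset.
    move: u12; rewrite cat_uniq => /and3P[_ /hasPn d _].
    split; apply/fsetP => x; rewrite ?(in_cFIu _ w) ?(in_cFIl _ w) !inE /=;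
      have /implyP := d x; bool_cases.
  rewrite dus dls; case: p s1 s2 {w dus dls} => p /= s1 s2.
    have wp : atom_wf v p us ls by rewrite /atom_wf s1 s2.
    by split; rewrite ?(mval_up M wp) ?(mval_low M wp) //; apply: mval_type.
  have wp : atom_wf v p (rev ls) (rev us).
    by rewrite /atom_wf !size_rev s1 s2 -rev_cat rev_uniq.
  rewrite (mval_up M wp) (mval_low M wp); split.
  + by apply: pdual_type; have [] := mval_type M wp.
  + by apply/fsetP => x; rewrite !inE /= mem_rev.
  + by apply/fsetP => x; rewrite !inE /= mem_rev.
- have /and3P[/= ij _ _] := w.
  split; first by apply: pdual_type; apply: pdual_pretype; apply: pdelta_pretype.
    by apply/fsetP => x; rewrite (in_cFIu _ w) /= !inE; case: eqVneq => // ->.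
  apply/fsetP => x; rewrite (in_cFIl _ w) /= !inE andbC.
  by case: (eqVneq x j) => [->|]; rewrite ?andbF // eq_sym ij.
- have /and3P[/= ij _ _] := w.
  split; first by apply: pdual_type; apply: pdelta_pretype; rewrite eq_sym.
    by apply/fsetP => x; rewrite (in_cFIu _ w) /= !inE; case: eqVneq => // ->.
  apply/fsetP => x; rewrite (in_cFIl _ w) /= !inE andbC.
  by case: (eqVneq x j) => [->|]; rewrite ?andbF // eq_sym ij.
- have [wA wB AB] := cwf_tensP w; have [[[pA _] uA lA] [[pB _] uB lB]] := (IA wA, IB wB).
  have [du dl] := separated_FI wA wB AB; have [-> ->] := cFI_tens w.
  rewrite -uA -lA -uB -lB; split=> //.
  by apply: ptensor_type; rewrite ?uA ?uB ?lA ?lB.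
- have [wA wB AB] := cwf_parP w; have [[[pA _] uA lA] [[pB _] uB lB]] := (IA wA, IB wB).
  have [du dl] := separated_FI wA wB AB; have [-> ->] := cFI_par w.
  rewrite -uA -lA -uB -lB; split=> //.
  by apply: ppar_type; rewrite ?uA ?uB ?lA ?lB.
Qed.

Lemma cinterp_dual A : cwf v A -> cinterp M (cdual A) = dual (cinterp M A).
Proof.
elim: A => [p us ls|i j|i j|A IA B IB|A IA B IB] w.
- case: p w => p w; first by rewrite /= !revK.
  (* A negative atom is interpreted as a dual, so the claim is that the valuation of the positive
     atom is a bidual. *)
  by move: w; rewrite -cwf_dual => /cinterp_type[[]].
- rewrite /= /punit tridual //; apply: pdelta_pretype.
  by case/and3P: w.
- by [].
- have [wA wB AB] := cwf_tensP w.
  have [[tA uA lA] [tB uB lB]] := (cinterp_type wA, cinterp_type wB).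
  have [du dl] := separated_FI wA wB AB.
  by rewrite /= IA // IB // dual_ptensor ?uA ?lA ?uB ?lB.
- have [wA wB AB] := cwf_parP w.
  have [[[pA _] uA lA] [[pB _] uB lB]] := (cinterp_type wA, cinterp_type wB).
  have [du dl] := separated_FI wA wB AB.
  by rewrite /= IA // IB // dual_ppar ?uA ?lA ?uB ?lB.
Qed.

(** The single upper occurrence of [j] lies in one component, and the substitution fixes the other.
    The renaming lemmas treat the left factor; a right component is reached by commutativity. *)
Lemma cinterp_csubu A i j : cwf v A -> j \in cFIu A ->
  i \notin cup A -> i \notin clow A ->
  cinterp M (csubu i j A) = prenu i j (cinterp M A).
Proof.
elim: A => [p us ls|x y|x y|A IA B IB|A IA B IB] w;
  rewrite (in_cFIu _ w) => /andP[jA jA'] iu il.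
- have /and3P[/and3P[s1 s2 u12] _ _] := w.
  rewrite /= in jA jA' iu il; case: p s1 s2 {w} => p /= s1 s2.
    have wp : atom_wf v p us ls by rewrite /atom_wf s1 s2.
    by apply: mval_subu => //; rewrite mem_cat negb_or iu.
  have wp : atom_wf v p (rev ls) (rev us).
    by rewrite /atom_wf !size_rev s1 s2 -rev_cat rev_uniq.
  (* An upper index of a negative atom is a lower index of the positive atom under the dual. *)
  rewrite -map_rev mval_subl //; last by rewrite mem_cat negb_or !mem_rev il.
    rewrite pdual_prenl ?(mval_up M wp) ?(mval_low M wp) ?inE ?mem_rev //.
    by have [] := mval_type M wp.
  by rewrite mem_rev.
- have /and3P[/= xy _ _] := w.
  move: jA jA' iu il; rewrite /= !inE => /eqP je jA' iu il; subst.
  rewrite /repl eqxx /punit; have pd := pdelta_pretype (alphabet (msys M)) xy.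
  rewrite -pdual_prenl -?pdual_prenu ?prenu_pdelta ?inE //; first exact: pdual_pretype.
- have /and3P[/= xy _ _] := w.
  move: jA jA' iu il; rewrite /= !inE => /eqP je jA' iu il; subst.
  have yx : y != x by rewrite eq_sym.
  rewrite /repl eqxx /pbot; have pd := pdelta_pretype (alphabet (msys M)) yx.
  by rewrite -pdual_prenl ?prenl_pdelta ?inE.
- have [wA wB AB] := cwf_tensP w; rewrite /= in iu il jA jA' *.
  have [[[pA _] uA lA] [[pB _] uB lB]] := (cinterp_type wA, cinterp_type wB).
  have [du dl] := separated_FI wA wB AB; have [ABu ABl] := AB j.
  move: jA jA' iu il; rewrite !mem_cat !negb_or.
  move=> jA /andP[jA'1 jA'2] /andP[iuA iuB] /andP[ilA ilB].
  case/orP: jA => j_.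
    have jB : j \notin cup B by move: ABu; apply: contraNN => ->; rewrite j_.
    have jFI : j \in cFIu A by rewrite (in_cFIu _ wA) j_ jA'1.
    rewrite [csubu i j B]csubu_id // IA // prenu_ptensorl // ?uA ?lA ?uB ?lB //;
    by rewrite ?(in_cFIu _ wA) ?(in_cFIu _ wB) ?(in_cFIl _ wA) ?(in_cFIl _ wB)
      ?(negPf iuA) ?(negPf iuB) ?(negPf ilA) ?(negPf ilB) ?(negPf jA'2) ?(negPf jB).
  have jB : j \notin cup A by move: ABu; apply: contraNN => ->; rewrite j_.
  have jFI : j \in cFIu B by rewrite (in_cFIu _ wB) j_ jA'2.
  rewrite [csubu i j A]csubu_id // IB //.
  have iF : [/\ i \notin pu (cinterp M A), i \notin pl (cinterp M A),
      i \notin pu (cinterp M B) & i \notin pl (cinterp M B)].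
    by rewrite uA lA uB lB ?(in_cFIu _ wA) ?(in_cFIu _ wB) ?(in_cFIl _ wA)
      ?(in_cFIl _ wB) ?(negPf iuA) ?(negPf iuB) ?(negPf ilA) ?(negPf ilB).
  have [i1 i2 i3 i4] := iF.
  have pr : is_pretype (prenu i j (cinterp M B)).
    by apply: prenu_pretype => //; rewrite ?lB ?uB.
  rewrite ptensorC //.
  + rewrite (@ptensorC _ _ _ (cinterp M A)) // ?uA ?uB ?lA ?lB //.
    rewrite prenu_ptensorl // ?uA ?lA ?uB ?lB // 1?fdisjoint_sym //.
    by rewrite (in_cFIl _ wA) (negPf jA'1).
  + by rewrite -uA -uB in du *; clear -i1 i2 i3 i4 du dl; rewrite /=; fset_dec.
  + by rewrite -lA -lB in dl *; clear -i1 i2 i3 i4 du dl; rewrite /=; fset_dec.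
- have [wA wB AB] := cwf_parP w; rewrite /= in iu il jA jA' *.
  have [[[pA _] uA lA] [[pB _] uB lB]] := (cinterp_type wA, cinterp_type wB).
  have [du dl] := separated_FI wA wB AB; have [ABu ABl] := AB j.
  move: jA jA' iu il; rewrite !mem_cat !negb_or.
  move=> jA /andP[jA'1 jA'2] /andP[iuA iuB] /andP[ilA ilB].
  case/orP: jA => j_.
    have jB : j \notin cup B by move: ABu; apply: contraNN => ->; rewrite j_.
    have jFI : j \in cFIu A by rewrite (in_cFIu _ wA) j_ jA'1.
    rewrite [csubu i j B]csubu_id // IA // prenu_pparl // ?uA ?lA ?uB ?lB //;
    by rewrite ?(in_cFIu _ wA) ?(in_cFIu _ wB) ?(in_cFIl _ wA) ?(in_cFIl _ wB)
      ?(negPf iuA) ?(negPf iuB) ?(negPf ilA) ?(negPf ilB) ?(negPf jA'2) ?(negPf jB).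
  have jB : j \notin cup A by move: ABu; apply: contraNN => ->; rewrite j_.
  have jFI : j \in cFIu B by rewrite (in_cFIu _ wB) j_ jA'2.
  rewrite [csubu i j A]csubu_id // IB //.
  have iF : [/\ i \notin pu (cinterp M A), i \notin pl (cinterp M A),
      i \notin pu (cinterp M B) & i \notin pl (cinterp M B)].
    by rewrite uA lA uB lB ?(in_cFIu _ wA) ?(in_cFIu _ wB) ?(in_cFIl _ wA)
      ?(in_cFIl _ wB) ?(negPf iuA) ?(negPf iuB) ?(negPf ilA) ?(negPf ilB).
  have [i1 i2 i3 i4] := iF.
  have pr : is_pretype (prenu i j (cinterp M B)).
    by apply: prenu_pretype => //; rewrite ?lB ?uB.
  rewrite pparC //.
  + rewrite (@pparC _ _ _ (cinterp M A)) // ?uA ?uB ?lA ?lB //.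
    rewrite prenu_pparl // ?uA ?lA ?uB ?lB // 1?fdisjoint_sym //.
    by rewrite (in_cFIl _ wA) (negPf jA'1).
  + by rewrite -uA -uB in du *; clear -i1 i2 i3 i4 du dl; rewrite /=; fset_dec.
  + by rewrite -lA -lB in dl *; clear -i1 i2 i3 i4 du dl; rewrite /=; fset_dec.
Qed.

Lemma cinterp_csubl A i j : cwf v A -> j \in cFIl A ->
  i \notin cup A -> i \notin clow A ->
  cinterp M (csubl i j A) = prenl i j (cinterp M A).
Proof.
elim: A => [p us ls|x y|x y|A IA B IB|A IA B IB] w;
  rewrite (in_cFIl _ w) => /andP[jA jA'] iu il.
- have /and3P[/and3P[s1 s2 u12] _ _] := w.
  rewrite /= in jA jA' iu il; case: p s1 s2 {w} => p /= s1 s2.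
    have wp : atom_wf v p us ls by rewrite /atom_wf s1 s2.
    by apply: mval_subl => //; rewrite mem_cat negb_or iu.
  have wp : atom_wf v p (rev ls) (rev us).
    by rewrite /atom_wf !size_rev s1 s2 -rev_cat rev_uniq.
  rewrite -map_rev mval_subu //; last by rewrite mem_cat negb_or !mem_rev il.
    rewrite pdual_prenu ?(mval_up M wp) ?(mval_low M wp) ?inE ?mem_rev //.
    by have [] := mval_type M wp.
  by rewrite mem_rev.
- have /and3P[/= xy _ _] := w.
  move: jA jA' iu il; rewrite /= !inE => /eqP je jA' iu il; subst.
  rewrite /repl eqxx /punit; have pd := pdelta_pretype (alphabet (msys M)) xy.
  rewrite -pdual_prenu -?pdual_prenl ?prenl_pdelta ?inE //; first exact: pdual_pretype.
- have /and3P[/= xy _ _] := w.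
  move: jA jA' iu il; rewrite /= !inE => /eqP je jA' iu il; subst.
  have yx : y != x by rewrite eq_sym.
  rewrite /repl eqxx /pbot; have pd := pdelta_pretype (alphabet (msys M)) yx.
  by rewrite -pdual_prenu ?prenu_pdelta ?inE.
- have [wA wB AB] := cwf_tensP w; rewrite /= in iu il jA jA' *.
  have [[[pA _] uA lA] [[pB _] uB lB]] := (cinterp_type wA, cinterp_type wB).
  have [du dl] := separated_FI wA wB AB; have [ABu ABl] := AB j.
  move: jA jA' iu il; rewrite !mem_cat !negb_or.
  move=> jA /andP[jA'1 jA'2] /andP[iuA iuB] /andP[ilA ilB].
  case/orP: jA => j_.
    have jB : j \notin clow B by move: ABl; apply: contraNN => ->; rewrite j_.
    have jFI : j \in cFIl A by rewrite (in_cFIl _ wA) j_ jA'1.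
    rewrite [csubl i j B]csubl_id // IA // prenl_ptensorl // ?uA ?lA ?uB ?lB //;
    by rewrite ?(in_cFIu _ wA) ?(in_cFIu _ wB) ?(in_cFIl _ wA) ?(in_cFIl _ wB)
      ?(negPf iuA) ?(negPf iuB) ?(negPf ilA) ?(negPf ilB) ?(negPf jA'2) ?(negPf jB).
  have jB : j \notin clow A by move: ABl; apply: contraNN => ->; rewrite j_.
  have jFI : j \in cFIl B by rewrite (in_cFIl _ wB) j_ jA'2.
  rewrite [csubl i j A]csubl_id // IB //.
  have iF : [/\ i \notin pu (cinterp M A), i \notin pl (cinterp M A),
      i \notin pu (cinterp M B) & i \notin pl (cinterp M B)].
    by rewrite uA lA uB lB ?(in_cFIu _ wA) ?(in_cFIu _ wB) ?(in_cFIl _ wA)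
      ?(in_cFIl _ wB) ?(negPf iuA) ?(negPf iuB) ?(negPf ilA) ?(negPf ilB).
  have [i1 i2 i3 i4] := iF.
  have pr : is_pretype (prenl i j (cinterp M B)).
    by apply: prenl_pretype => //; rewrite ?lB ?uB.
  rewrite ptensorC //.
  + rewrite (@ptensorC _ _ _ (cinterp M A)) // ?uA ?uB ?lA ?lB //.
    rewrite prenl_ptensorl // ?uA ?lA ?uB ?lB // 1?fdisjoint_sym //.
    by rewrite (in_cFIu _ wA) (negPf jA'1).
  + by rewrite -uA -uB in du *; clear -i1 i2 i3 i4 du dl; rewrite /=; fset_dec.
  + by rewrite -lA -lB in dl *; clear -i1 i2 i3 i4 du dl; rewrite /=; fset_dec.
- have [wA wB AB] := cwf_parP w; rewrite /= in iu il jA jA' *.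
  have [[[pA _] uA lA] [[pB _] uB lB]] := (cinterp_type wA, cinterp_type wB).
  have [du dl] := separated_FI wA wB AB; have [ABu ABl] := AB j.
  move: jA jA' iu il; rewrite !mem_cat !negb_or.
  move=> jA /andP[jA'1 jA'2] /andP[iuA iuB] /andP[ilA ilB].
  case/orP: jA => j_.
    have jB : j \notin clow B by move: ABl; apply: contraNN => ->; rewrite j_.
    have jFI : j \in cFIl A by rewrite (in_cFIl _ wA) j_ jA'1.
    rewrite [csubl i j B]csubl_id // IA // prenl_pparl // ?uA ?lA ?uB ?lB //;
    by rewrite ?(in_cFIu _ wA) ?(in_cFIu _ wB) ?(in_cFIl _ wA) ?(in_cFIl _ wB)
      ?(negPf iuA) ?(negPf iuB) ?(negPf ilA) ?(negPf ilB) ?(negPf jA'2) ?(negPf jB).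
  have jB : j \notin clow A by move: ABl; apply: contraNN => ->; rewrite j_.
  have jFI : j \in cFIl B by rewrite (in_cFIl _ wB) j_ jA'2.
  rewrite [csubl i j A]csubl_id // IB //.
  have iF : [/\ i \notin pu (cinterp M A), i \notin pl (cinterp M A),
      i \notin pu (cinterp M B) & i \notin pl (cinterp M B)].
    by rewrite uA lA uB lB ?(in_cFIu _ wA) ?(in_cFIu _ wB) ?(in_cFIl _ wA)
      ?(in_cFIl _ wB) ?(negPf iuA) ?(negPf iuB) ?(negPf ilA) ?(negPf ilB).
  have [i1 i2 i3 i4] := iF.
  have pr : is_pretype (prenl i j (cinterp M B)).
    by apply: prenl_pretype => //; rewrite ?lB ?uB.
  rewrite pparC //.
  + rewrite (@pparC _ _ _ (cinterp M A)) // ?uA ?uB ?lA ?lB //.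
    rewrite prenl_pparl // ?uA ?lA ?uB ?lB // 1?fdisjoint_sym //.
    by rewrite (in_cFIu _ wA) (negPf jA'1).
  + by rewrite -uA -uB in du *; clear -i1 i2 i3 i4 du dl; rewrite /=; fset_dec.
  + by rewrite -lA -lB in dl *; clear -i1 i2 i3 i4 du dl; rewrite /=; fset_dec.
Qed.

(** * Soundness of the rules of TTL *)

Local Notation tt := (tterm Ind (alphabet (msys M))).
Implicit Types (ts : seq tt) (t : tt).

Lemma has_Permutation (S : Type) (a : pred S) (l l' : seq S) :
  Permutation l l' -> has a l = has a l'.
Proof. by elim=> //= [x k k' _ ->|x y k|k k' k'' _ -> _ ->] //; rewrite orbCA. Qed.

Lemma in_bigfsetU (S : Type) (F : S -> {fset Ind}) (l : seq S) x :
  (x \in \big[fsetU/fset0]_(a <- l) F a)%fset = has (fun a => x \in F a) l.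
Proof. by elim: l => [|a l IH]; rewrite ?big_nil ?big_cons ?in_fsetU /= ?IH. Qed.

Lemma cseq_wf_perm G G' : Permutation G G' -> cseq_wf v G -> cseq_wf v G'.
Proof.
move=> GG [wG pu pl e]; split.
- rewrite -[all _ _]negbK -has_predC -(has_Permutation _ GG) has_predC negbK //.
- by apply: pairwise_Permutation GG pu => A B; apply: fdisjoint_sym.
- by apply: pairwise_Permutation GG pl => A B; apply: fdisjoint_sym.
- apply/fsetP => x; have /fsetP/(_ x) := e.
  by rewrite !in_bigfsetU !(has_Permutation _ GG).
Qed.

(** [cseq_wf] without the balance of free indices, which tails of a sequent need not satisfy; the
    part kept here is inherited by tails and supports induction on the context. *)
Definition ctx_wf G := [/\ all (cwf v) G,
  pairwise (fun A B => [disjoint cFIu A & cFIu B]%fset) G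
  & pairwise (fun A B => [disjoint cFIl A & cFIl B]%fset) G].

Lemma ctx_wf_cons A G : ctx_wf (A :: G) -> forall x,
  ~~ ((x \in cFIu A) && has (fun B => x \in cFIu B) G) /\
  ~~ ((x \in cFIl A) && has (fun B => x \in cFIl B) G).
Proof.
case=> _ /= /andP[Au _] /andP[Al _] x; split.
  elim: G Au {Al} => [|B G IH] /=; rewrite ?andbF // => /andP[d /IH].
  by have := disjoint_pt d x; rewrite andb_orr negb_or => -> ->.
elim: G Al {Au} => [|B G IH] /=; rewrite ?andbF // => /andP[d /IH].
by have := disjoint_pt d x; rewrite andb_orr negb_or => -> ->.
Qed.

Definition duals G ts :=
  List.Forall2 (fun A t => pset (dual (cinterp M A)) t) G ts.

(* Validity with all formulas treated alike, the products of elements of their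
   duals being required to lie in the dualizing type. *)
Definition csound G := forall ts, duals G ts -> pset D (prods ts).

Lemma FI_duals A t : cwf v A -> pset (dual (cinterp M A)) t ->
  FIu t = cFIl A /\ FIl t = cFIu A.
Proof. by move=> /cinterp_type[_ <- <-] []. Qed.

Lemma compat_duals G ts : all (cwf v) G ->
  pairwise (fun A B => [disjoint cFIu A & cFIu B]%fset) G ->
  pairwise (fun A B => [disjoint cFIl A & cFIl B]%fset) G ->
  duals G ts -> pairwise (@compat _ _) ts.
Proof.
move=> wG pu pl dG; elim: dG wG pu pl => //= {G ts} A t G ts At dG IH.
move=> /andP[wA wG] /andP[Au pu] /andP[Al pl]; rewrite IH // andbT.
have [ut lt] := FI_duals wA At.
elim: dG wG Au Al {IH pu pl} => //= {G ts} B s G ts Bs _ IH.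
move=> /andP[wB wG] /andP[ABu Au] /andP[ABl Al]; rewrite IH // andbT.
by have [us ls] := FI_duals wB Bs; rewrite /compat ut lt us ls ABu ABl.
Qed.

Lemma has_duals G ts x : all (cwf v) G -> duals G ts ->
  has (fun t => x \in FIu t) ts = has (fun A => x \in cFIl A) G /\
  has (fun t => x \in FIl t) ts = has (fun A => x \in cFIu A) G.
Proof.
move=> wG dG; elim: dG wG => //= {G ts} A t G ts At _ IH /andP[wA wG].
by have [-> ->] := IH wG; have [-> ->] := FI_duals wA At.
Qed.

(** Well-formedness makes the factors pairwise composable, and only then may a product be
    reordered. *)
Lemma csound_perm G G' : Permutation G G' -> cseq_wf v G -> csound G -> csound G'.
Proof.
move=> GG [wG pu pl _] sG ts' dG'.
have [ts [tt_ dG]] := Permutation_Forall2 (Permutation_sym GG) dG'.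
rewrite -(prods_Permutation (Permutation_sym tt_)); first exact: sG.
exact: compat_duals dG.
Qed.

(** An index free in the product is unmatched within [G], so balance of the sequent matches it with
    [A]. Duals exchange upper and lower, which puts it on the same side as in [A]. *)
Lemma FI_prods_duals A G ts : cseq_wf v (A :: G) -> duals G ts ->
  FIu (prods ts) = cFIu A /\ FIl (prods ts) = cFIl A.
Proof.
move=> [/= /andP[wA wG] /andP[Au pu] /andP[Al pl] e] dG.
have pts := compat_duals wG pu pl dG.
have wc : ctx_wf (A :: G) by split; apply/andP.
have key x : ((x \in cFIu A) || has (fun B => x \in cFIu B) G) =
    ((x \in cFIl A) || has (fun B => x \in cFIl B) G).
  by have /fsetP/(_ x) := e; rewrite !in_bigfsetU.
have dA x : ~~ ((x \in cFIu A) && (x \in cFIl A)).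
  by rewrite (in_cFIu _ wA) (in_cFIl _ wA); bool_cases.
split; apply/fsetP => x; have [eu el] := FI_prods x pts;
  have [hu hl] := has_duals x wG dG; have [k1 k2] := ctx_wf_cons wc x;
  move: (dA x) k1 k2 (key x);
  rewrite ?eu ?el hu hl; bool_cases.
Qed.

(** Membership in a bidual prescribes a boundary besides the pairings; this is where balance of the
    sequent enters. *)
Lemma csoundP A G : cseq_wf v (A :: G) ->
  csound (A :: G) <-> (forall ts, duals G ts -> pset (cinterp M A) (prods ts)).
Proof.
move=> w; have [/= /andP[wA _] _ _ _] := w.
have [[pA eA] uA lA] := cinterp_type wA; have pdA := pdual_pretype D pA.
split=> [sG ts dG|sG ts dG].
  rewrite eA; apply/pdualP => //; have [-> ->] := FI_prods_duals w dG.
  by split=> // t At; apply: (sG (t :: ts)); constructor.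
inversion dG as [|B t H ts' At dts e1 e2]; subst; move: (sG _ dts).
by rewrite {1}eA => /pdualP[] // _ _; apply.
Qed.

Lemma duals_cat G G' ts : duals (G ++ G') ts ->
  exists ts1 ts2, [/\ duals G ts1, duals G' ts2 & ts = ts1 ++ ts2].
Proof. by case/List.Forall2_app_inv_l => ts1 [ts2 [? [? ->]]]; exists ts1, ts2. Qed.

Lemma TTL_wf G : TTL v G -> cseq_wf v G.
Proof. by elim=> // G' G'' GG _; apply: cseq_wf_perm. Qed.

Lemma TTL_sound G : TTL v G -> csound G.
Proof.
have permA G' As : Permutation (G' ++ As) (As ++ G') by apply: Permutation_app_comm.
elim=> {G}.
- by move=> G G' GG /TTL_wf wG sG; apply: csound_perm sG.
- move=> A _ w; apply/csoundP => // ts dts.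
  have [/= /andP[_ /andP[wA _]] _ _ _] := w.
  inversion dts as [|B t H ts' At dts' e1 e2]; subst.
  inversion dts'; subst.
  by rewrite /= tmult1 cinterp_dual.
- move=> G G' A /TTL_wf wGA sGA /TTL_wf wAG sAG w ts dts.
  have [ts1 [ts2 [d1 d2 e]]] := duals_cat dts.
  have w1 : cseq_wf v (A :: G) := cseq_wf_perm (permA _ _) wGA.
  have s1 : csound (A :: G) := csound_perm (permA _ _) wGA sGA.
  have pA1 := iffLR (csoundP w1) s1 _ d1.
  have wA : cwf v A by case: w1 => /= /andP[].
  (* The product over [G] lies in the interpretation of [A], the product over [G'] in its dual;
     pairing them gives the product over the conclusion. *)
  have := iffLR (csoundP wAG) sAG _ d2; rewrite cinterp_dual //.
  have [[pA _] _ _] := cinterp_type wA.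
  case/pdualP => // _ _ /(_ _ pA1); rewrite -prods_cat -?e //.
  by case: w => *; apply: compat_duals dts.
- move=> G G' A B /TTL_wf wGA sGA /TTL_wf wBG sBG w.
  have pm : Permutation (CTens A B :: G ++ G') (G ++ CTens A B :: G').
    exact: Permutation_middle.
  have w' := cseq_wf_perm (Permutation_sym pm) w.
  apply: (csound_perm pm w'); apply/csoundP => // ts dts.
  have [ts1 [ts2 [d1 d2 e]]] := duals_cat dts.
  have w1 : cseq_wf v (A :: G) := cseq_wf_perm (permA _ _) wGA.
  have s1 : csound (A :: G) := csound_perm (permA _ _) wGA sGA.
  have pA1 := iffLR (csoundP w1) s1 _ d1.
  have pB2 := iffLR (csoundP wBG) sBG _ d2.
  have [/= /andP[wAB wGG] /andP[_ pu] /andP[_ pl] _] := w'.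
  have [wA wB AB] := cwf_tensP wAB.
  have [[[pA _] uA lA] [[pB _] uB lB]] := (cinterp_type wA, cinterp_type wB).
  have [du dl] := separated_FI wA wB AB; rewrite -uA -uB in du; rewrite -lA -lB in dl.
  apply: (sub_bidual D (pmul_pretype pA pB du dl)).
  apply/pmulP => //; exists (prods ts1), (prods ts2); split=> //.
  rewrite -prods_cat -e //; exact: compat_duals dts.
- move=> G A B /TTL_wf wG sG w.
  have w' : cseq_wf v (CPar A B :: G) := cseq_wf_perm (permA _ _) w.
  apply: (csound_perm (permA [:: CPar A B] G) w'); apply/csoundP => // ts dts.
  have [FIu_ts FIl_ts] := FI_prods_duals w' dts.
  have [/= /andP[wAB _] _ _ _] := w'.
  have [_ uAB lAB] := cinterp_type wAB.
  have [wA wB AB] := cwf_parP wAB.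
  have [[[pA _] uA lA] [[pB _] uB lB]] := (cinterp_type wA, cinterp_type wB).
  have [du dl] := separated_FI wA wB AB; rewrite -uA -uB in du; rewrite -lA -lB in dl.
  have [pdA pdB] := (pdual_pretype D pA, pdual_pretype D pB).
  apply/(pdualP D _ (pmul_pretype pdA pdB dl du)).
  split; [by rewrite FIu_ts -uAB|by rewrite FIl_ts -lAB|].
  (* Testing against a product [a] [b] is soundness of the premise for the list [a :: b :: ts]. *)
  move=> _ /pmulP[] // a [b [Aa Bb ->]].
  have s1 : csound (A :: B :: G) := csound_perm (permA _ _) wG sG.
  have [w1 w2 w3 _] : cseq_wf v (A :: B :: G) := cseq_wf_perm (permA _ _) wG.
  have dabts : duals (A :: B :: G) (a :: b :: ts).
    by constructor => //; constructor.
  have /= /andP[/andP[ab ats] /andP[bts pts]] := compat_duals w1 w2 w3 dabts.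
  by rewrite -tmulA ?compat_prods //; exact: (s1 _ dabts).
- move=> G A i j /TTL_wf wG sG jA iu il w.
  have w' : cseq_wf v (CBot Lit j i :: csubu i j A :: G) := cseq_wf_perm (permA _ _) w.
  apply: (csound_perm (permA [:: CBot Lit j i; csubu i j A] G) w').
  apply/csoundP => // qts dqts; have [FIu_q FIl_q] := FI_prods_duals w' dqts.
  inversion dqts as [|A' q H ts A'q dts e1 e2]; subst.
  have [/= /and3P[wbot wA' _] _ _ _] := w'.
  have w1 : cseq_wf v (A :: G) := cseq_wf_perm (permA _ _) wG.
  have s1 : csound (A :: G) := csound_perm (permA _ _) wG sG.
  have wA : cwf v A by case: w1 => /= /andP[].
  have [[pA _] uA lA] := cinterp_type wA.
  have [iA1 iA2] := csubu_fresh wA wA' jA iu il.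
  have e : cinterp M (csubu i j A) = prenu i j (cinterp M A) by apply: cinterp_csubu.
  have pts := iffLR (csoundP w1) s1 _ dts.
  have [FIu_ts FIl_ts] := FI_prods_duals w1 dts.
  have ij : i != j by apply: contraTneq jA => <-.
  have jl : j \notin cFIl A.
    by move: jA; rewrite (in_cFIu _ wA) (in_cFIl _ wA) => /andP[_ /negPf ->].
  have dA : [disjoint cFIu A & cFIl A]%fset by rewrite -uA -lA; case: pA.
  have [_ ubot lbot] := cinterp_type wbot.
  apply/(pdualP D _ (pdelta_pretype _ ij)).
  rewrite FIu_q FIl_q -ubot -lbot; split=> // _ ->.
  have := A'q; rewrite e => -[FIu_q1 FIl_q1 _].
  move: A'q; rewrite e => /pdualP[]; first by apply: prenu_pretype; rewrite ?uA ?lA.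
  (* The product over [G] lies in the interpretation of [A], so its product with delta^i_j lies in
     that of the renamed formula and pairs with [q]. The same delta is the one element against which
     bot^j_i is tested. *)
  move=> _ _ /(_ (tmul (prods ts) (tdelta _ i j))) Dq.
  have cq : compat (tdelta (alphabet (msys M)) i j) q.
    rewrite compatC compat_tdelta // FIu_q1 FIl_q1 /= uA lA.
    by apply/andP; split; clear -dA iu il jA ij; fset_dec.
  have ct : compat (tdelta (alphabet (msys M)) i j) (prods ts).
    by rewrite compatC compat_tdelta // FIu_ts FIl_ts iu.
  have cqt : compat (prods ts) q.
    rewrite /compat FIu_q1 FIl_q1 /= uA lA FIu_ts FIl_ts.
    by apply/andP; split; clear -dA iu il jA ij; fset_dec.
  have -> : tmul (tdelta _ i j) (prods (q :: ts)) =
      tmul (tmul (prods ts) (tdelta (alphabet (msys M)) i j)) q.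
    by rewrite /= -(tmulC cqt) tmulA // (tmulC ct).
  apply: Dq; apply/prenuP; rewrite ?uA ?lA //; exists (prods ts) => //.
- move=> G A i j /TTL_wf wG sG jA iu il w.
  have w' : cseq_wf v (csubl i j A :: G) := cseq_wf_perm (permA _ _) w.
  apply: (csound_perm (permA [:: csubl i j A] G) w'); apply/csoundP => // ts dts.
  have w1 : cseq_wf v (A :: CBot Lit j i :: G) := cseq_wf_perm (permA _ _) wG.
  have s1 : csound (A :: CBot Lit j i :: G) := csound_perm (permA _ _) wG sG.
  have [/= /andP[wA' _] _ _ _] := w'.
  have [/= /and3P[wA wbot _] _ _ _] := w1.
  have [[pA _] uA lA] := cinterp_type wA.
  have [_ uA' lA'] := cinterp_type wA'.
  have [iA1 iA2] := csubl_fresh wA wA' jA iu il.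
  have e : cinterp M (csubl i j A) = prenl i j (cinterp M A) by apply: cinterp_csubl.
  have [FIu_ts FIl_ts] := FI_prods_duals w' dts.
  have ij : i != j by apply: contraTneq jA => <-.
  have ju : j \notin cFIu A.
    by move: jA; rewrite (in_cFIu _ wA) (in_cFIl _ wA) => /andP[_ /negPf ->].
  rewrite -uA' e /= uA in FIu_ts; rewrite -lA' e /= lA in FIl_ts.
  have ct : compat (tdelta (alphabet (msys M)) i j) (prods ts).
    by rewrite compatC compat_tdelta // FIu_ts FIl_ts iu /=; clear -ij; fset_dec.
  (* As bot^j_i is the dual of delta^i_j, its own dual contains that delta. The premise then puts
     the product over [G], with lower [i] renamed back to [j], into the interpretation of [A]. *)
  have dd : duals (CBot Lit j i :: G) (tdelta _ i j :: ts).
    by constructor => //; apply: sub_bidual => //; apply: pdelta_pretype.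
  have := iffLR (csoundP w1) s1 _ dd; rewrite /= (tmulC ct) => At.
  rewrite e; apply/prenlP; rewrite ?uA ?lA //.
  exists (tmul (prods ts) (tdelta (alphabet (msys M)) i j)) => //.
  by rewrite tmul_tdeltalK // ?FIu_ts ?FIl_ts //; clear -ij ju jA il iu; fset_dec.
Qed.

(** * From soundness to membership of 1 in the iterated cotensor product *)

Local Notation pars G := (ppars D (map (cinterp M) G)).

Lemma ctx_wf_tail A G : ctx_wf (A :: G) -> ctx_wf G.
Proof. by case=> /= /andP[_ ?] /andP[_ ?] /andP[_ ?]. Qed.

Lemma ctx_wf_head A G : ctx_wf (A :: G) -> cwf v A.
Proof. by case=> /= /andP[]. Qed.

(** A singleton has its own clause in [ppars], so the inductions below treat an empty tail apart. *)
Lemma ppars_cons A G : G <> [::] ->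
  pars (A :: G) = ppar D (cinterp M A) (pars G).
Proof. by case: G. Qed.

Lemma in_ppars G x : ctx_wf G ->
  (x \in pu (pars G)) =
    has (fun A => x \in cFIu A) G && ~~ has (fun A => x \in cFIl A) G /\
  (x \in pl (pars G)) =
    has (fun A => x \in cFIl A) G && ~~ has (fun A => x \in cFIu A) G.
Proof.
elim: G => [|A G IH] w; first by rewrite /= dualizing_up dualizing_low !in_fset0.
have [k1 k2] := ctx_wf_cons w x; have w' := ctx_wf_tail w.
have wA := ctx_wf_head w; have [_ uA lA] := cinterp_type wA.
have dA : ~~ ((x \in cFIu A) && (x \in cFIl A)).
  by rewrite (in_cFIu _ wA) (in_cFIl _ wA); bool_cases.
have [->|nG] : G = [::] \/ G <> [::] by case: (G); [left|right].
  by rewrite /= uA lA; move: dA; bool_cases.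
have [eu el] := IH w'; rewrite (ppars_cons A nG) /= !in_bprod uA lA eu el.
by move: dA k1 k2; bool_cases.
Qed.

Lemma ppars_pretype G : ctx_wf G -> is_pretype (pars G).
Proof.
elim: G => [|A G IH] w; first exact: dualizing_pretype.
have w' := ctx_wf_tail w; have pG := IH w'.
have wA := ctx_wf_head w; have [[pA _] uA lA] := cinterp_type wA.
have [->|nG] : G = [::] \/ G <> [::] by case: (G); [left|right].
  exact: pA.
rewrite (ppars_cons A nG); apply: (ppar_type D pA pG _ _).1; apply/fdisjointP => x;
  rewrite ?uA ?lA; have [k1 k2] := ctx_wf_cons w x; have [eu el] := in_ppars x w';
  rewrite ?eu ?el negb_and negbK; move: k1 k2; bool_cases.
Qed.

Lemma compat_ppars G r ts : ctx_wf G ->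
  FIu r = pu (pars G) -> FIl r = pl (pars G) -> duals G ts -> all (compat r) ts.
Proof.
move=> w ur lr dG; have [wG _ _] := w; apply/allP => t tts.
apply/andP; split; apply/fdisjointP => x; have [eu el] := in_ppars x w;
  have [hu hl] := has_duals x wG dG.
  by rewrite ur eu -hu => /andP[_]; apply: contraNN => xt; apply/hasP; exists t.
by rewrite lr el -hl => /andP[_]; apply: contraNN => xt; apply/hasP; exists t.
Qed.

(** Stated for arbitrary [r] rather than 1, because peeling off a formula multiplies [r] by an
    element of its dual. *)
Lemma ppars_intro G r : ctx_wf G ->
  FIu r = pu (pars G) -> FIl r = pl (pars G) ->
  (forall ts, duals G ts -> pset D (tmul r (prods ts))) -> pset (pars G) r.
Proof.
elim: G r => [|A G IH] r w ur lr Dr.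
  by rewrite -[r]tmult1; apply: (Dr [::]); constructor.
have w' := ctx_wf_tail w.
have wA := ctx_wf_head w; have [[pA eA] uA lA] := cinterp_type wA.
have pdA := pdual_pretype D pA; have pG := ppars_pretype w'.
have [G0|nG] : G = [::] \/ G <> [::] by case: (G); [left|right].
  rewrite G0 /= in ur lr Dr *; rewrite eA; apply/(pdualP D _ pdA); split=> // t At.
  have [ut lt] := FI_pretype pdA At.
  rewrite -tmulC; last first.
    by rewrite /compat ur lr ut lt /= (fdisjoint_sym (pl _)) pA.1.
  by rewrite -[t in tmul r t]tmult1; apply: (Dr [:: t]); constructor.
rewrite (ppars_cons A nG) in ur lr *.
have disj : [disjoint pu (cinterp M A) & pu (pars G)]%fset /\
    [disjoint pl (cinterp M A) & pl (pars G)]%fset.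
  by split; apply/fdisjointP => x; rewrite ?uA ?lA; have [k1 k2] := ctx_wf_cons w x;
    have [eu el] := in_ppars x w'; rewrite ?eu ?el negb_and negbK; move: k1 k2;
    bool_cases.
have [du dl] := disj; have [dA _] := pA; have [dG _] := pG.
have pdG := pdual_pretype D pG.
apply/(pdualP D _ (pmul_pretype pdA pdG dl du)); split=> // _ /pmulP[] // t [q [At Gq ->]].
have [ut lt] := FI_pretype pdA At; have [uq lq] := FI_pretype pdG Gq.
have ct : compat r t.
  by rewrite /compat ur lr ut lt; apply/andP; split; clear -dA dG du dl; fset_dec.
have cq : compat r q.
  by rewrite /compat ur lr uq lq; apply/andP; split; clear -dA dG du dl; fset_dec.
have ctq : compat t q by rewrite /compat ut lt uq lq dl.
have Grt : pset (pars G) (tmul r t).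
  apply: IH => //.
  - by rewrite FIu_mul // ur lr ut lt; clear -dA dG du dl; fset_dec.
  - by rewrite FIl_mul // ur lr ut lt; clear -dA dG du dl; fset_dec.
  move=> ts dts; have dtts : duals (A :: G) (t :: ts) by constructor.
  have [w1 w2 w3] := w.
  have /= /andP[tts pts] := compat_duals w1 w2 w3 dtts.
  have ur' : FIu r = pu (pars (A :: G)) by rewrite (ppars_cons A nG).
  have lr' : FIl r = pl (pars (A :: G)) by rewrite (ppars_cons A nG).
  have /= /andP[_ rts] := compat_ppars w ur' lr' dtts.
  by rewrite -tmulA ?compat_prods //; apply: (Dr _ dtts).
(* It remains to pair [tmul r t], which lies in the cotensor product of the tail, with [q] from its
   dual. *)
have [_ _ Pq] := iffLR (pdualP D _ pG) Gq.
rewrite -tmulC; first by rewrite tmulA //; apply: Pq.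
exact: compat_tmul.
Qed.

Lemma TTL_valid G : TTL v G -> cvalid M G.
Proof.
move=> dG; have sG := TTL_sound dG; have [w1 w2 w3 e] := TTL_wf dG.
have w : ctx_wf G by [].
have e' x : has (fun A => x \in cFIu A) G = has (fun A => x \in cFIl A) G.
  by have /fsetP/(_ x) := e; rewrite !in_bigfsetU.
apply: ppars_intro => //.
(* Balance leaves the cotensor product with empty boundary, which is that of 1. *)
- by apply/fsetP => x; have [-> _] := in_ppars x w; rewrite FIu_tone e' andbN in_fset0.
- by apply/fsetP => x; have [_ ->] := in_ppars x w; rewrite FIl_tone e' andbN in_fset0.
move=> ts dts; rewrite tmulC; first by rewrite tmult1; apply: sG.
by rewrite compatC compat_tone.
Qed.

End Interpretation.
End Formulas.

(** * Reading ITTL in TTL *)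

Section Translation.
Variables (Ind : choiceType) (Lit : Type) (v : Lit -> nat * nat).
Local Notation form := (cform Ind Lit).
Implicit Types (A B : iform Ind Lit) (i j x : Ind).

Fixpoint classical A : form :=
  match A with
  | IAtom p us ls => CAtom (Pos p) us ls
  | IOne i j => COne Lit i j
  | ITens A B => CTens (classical A) (classical B)
  | ILolli A B => CPar (cdual (classical A)) (classical B)
  end.

Lemma perm_classical A : perm_eq (cup (classical A)) (iocc true A) /\
  perm_eq (clow (classical A)) (iocc false A).
Proof.
elim: A => //= A [uA lA] B [uB lB]; first by split; apply: perm_cat.
have [u l] := perm_cdual (classical A).
by split; apply: perm_cat; rewrite ?(permPl u) ?(permPl l).
Qed.

Lemma cwf_classical A : cwf v (classical A) = iwf v A.
Proof.
have [u l] := perm_classical A; rewrite /cwf /iwf (perm_uniq u) (perm_uniq l).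
congr (_ && _).
elim: A {u l} => //= A eA B eB; first by rewrite eA eB.
by rewrite catoms_wf_dual eA eB.
Qed.

Lemma cFIu_classical A : cFIu (classical A) = iFIu A.
Proof. by have [u l] := perm_classical A; apply: once_perm. Qed.

Lemma cFIl_classical A : cFIl (classical A) = iFIl A.
Proof. by have [u l] := perm_classical A; apply: once_perm. Qed.

(** Dualising exchanges upper and lower, so the polarity flip left of an implication becomes the
    switch between [csubu] and [csubl]. *)
Lemma classical_isub b i j A : classical (isub b i j A) =
  if b then csubu i j (classical A) else csubl i j (classical A).
Proof.
elim: A b => [p us ls|x y|A IA B IB|A IA B IB] b /=; rewrite ?IA ?IB; case: b => //=.
  by rewrite csubu_dual.
by rewrite csubl_dual.
Qed.

(** The succedent stands at the head, where [csoundP] expects the distinguished formula. *)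
Definition classical_seq (G : seq (iform Ind Lit)) A : seq form :=
  classical A :: map (fun B => cdual (classical B)) G.

Lemma has_classical G x :
  has (fun C => x \in cFIu C) (map (fun B => cdual (classical B)) G) =
    (x \in iFIls G) /\
  has (fun C => x \in cFIl C) (map (fun B => cdual (classical B)) G) =
    (x \in iFIus G).
Proof.
by rewrite !has_map /iFIls /iFIus !in_bigfsetU; split; apply: eq_has => A /=;
  rewrite ?cFIu_dual ?cFIl_dual ?cFIu_classical ?cFIl_classical.
Qed.

Lemma cseq_wf_classical G A : iseq_wf v G A -> cseq_wf v (classical_seq G A).
Proof.
case=> /andP[wG wA] pu pl /andP[dul dlu] e; split.
- by rewrite /= cwf_classical wA all_map /=; apply: sub_all wG => B; 
    rewrite /= cwf_dual cwf_classical.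
- rewrite /= pairwise_map; apply/andP; split; last first.
    by move: pl; apply: sub_pairwise => B C; rewrite /= !cFIu_dual !cFIl_classical.
  elim: G dlu {wG pu pl dul e} => //= B G IH.
  rewrite /iFIls big_cons fdisjointUX => /andP[BA /IH ->].
  by rewrite cFIu_dual cFIl_classical cFIu_classical fdisjoint_sym BA.
- rewrite /= pairwise_map; apply/andP; split; last first.
    by move: pu; apply: sub_pairwise => B C; rewrite /= !cFIl_dual !cFIu_classical.
  elim: G dul {wG pu pl dlu e} => //= B G IH.
  rewrite /iFIus big_cons fdisjointUX => /andP[BA /IH ->].
  by rewrite cFIl_dual cFIl_classical cFIu_classical fdisjoint_sym BA.
apply/fsetP => x; rewrite !in_bigfsetU /=; have [-> ->] := has_classical G x.
rewrite cFIu_classical cFIl_classical; move/fsetP/(_ x): e.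
by rewrite !in_fsetU => e; rewrite orbC -e orbC.
Qed.

(** Every rule except exchange carries well-formedness of its conclusion. *)
Lemma ITTL_wf G A : ITTL v G A -> cseq_wf v (classical_seq G A).
Proof.
elim=> {G A} *; try exact: cseq_wf_classical.
apply: cseq_wf_perm; last by eassumption.
by apply: perm_skip; apply: Permutation_map.
Qed.

(** The rules of TTL fix the positions of their active formulas; this brings a goal into the order a
    rule expects and carries well-formedness along. *)
Lemma TTL_up_to_perm (X Y : seq form) : Permutation X Y -> cseq_wf v Y ->
  (cseq_wf v X -> TTL v X) -> TTL v Y.
Proof.
move=> XY wY TX; apply: (TTL_perm XY); apply: TX.
exact: cseq_wf_perm (Permutation_sym XY) wY.
Qed.

(** The dual of A -o B is the tensor of dual B with A, so the left implication rule is the tensor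
    rule; the right implication rule and the left tensor rule are the par rule. A unit 1^i_j on the
    left is bot^j_i, so both rules introducing it are instances of [TTL_botR] and both rules
    eliminating it are instances of [TTL_botL]. *)
Lemma TTL_classical G A : ITTL v G A -> TTL v (classical_seq G A).
Proof.
have pcons (X : seq form) C Y : Permutation (X ++ C :: Y) (C :: X ++ Y).
  exact/Permutation_sym/Permutation_middle.
have plast (X : seq form) C : Permutation (C :: X) (X ++ [:: C]).
  exact: Permutation_cons_append.
have pcat (X Y : seq form) : Permutation (X ++ Y) (Y ++ X).
  exact: Permutation_app_comm.
have pswap (X : seq form) C C' : Permutation (X ++ [:: C; C']) (X ++ [:: C'; C]).
  exact/Permutation_app_head/perm_swap.
elim=> {G A}; rewrite /classical_seq.
- move=> G G' A GG _; apply: TTL_perm.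
  by apply: perm_skip; apply: Permutation_map.
- move=> A atA /cseq_wf_classical wA.
  apply: (TTL_up_to_perm (perm_swap _ _ _) wA) => w.
  by apply: TTL_id w; case: A atA {wA}.
- move=> G G' A B _ IA _ IB /cseq_wf_classical; rewrite /classical_seq !map_cat => w.
  apply: (TTL_up_to_perm (pcons _ _ _) w) => w'; apply: TTL_cut w'.
    exact: (TTL_perm (plast _ _) IA).
  exact: (TTL_perm (perm_swap _ _ _) IB).
- move=> G G' A B C _ IA _ IB /cseq_wf_classical; rewrite /classical_seq !map_cat /=.
  rewrite cdualK => w.
  set X := map _ G; set X' := map _ G'.
  apply: (TTL_up_to_perm (_ : Permutation (_ :: X' ++ _ :: X) _) w).
    apply: perm_skip; apply: Permutation_trans (Permutation_sym (pcons _ _ _)).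
    apply: (Permutation_trans (pcons X' _ X)); apply: perm_skip; exact: pcat.
  rewrite -cat_cons => w'; apply: TTL_tens w' => //.
  apply: (TTL_perm _ IB); rewrite cat_cons; apply: perm_skip; exact: plast.
- move=> G A B _; rewrite map_cat => IB /cseq_wf_classical w.
  apply: (TTL_up_to_perm (Permutation_sym (plast _ _)) w) => w'; apply: TTL_par w'.
  by apply: (TTL_perm _ IB); rewrite -cat_rcons -cats1; apply: plast.
- move=> G A B C _; rewrite !map_cat -!cat_cons => IC /cseq_wf_classical.
  rewrite /classical_seq map_cat -cat_cons => w.
  apply: (TTL_par (A := cdual (classical B)) (B := cdual (classical A))) w.
  by apply: (TTL_perm _ IC); exact: pswap.
- move=> G G' A B _ IA _ IB /cseq_wf_classical; rewrite /classical_seq !map_cat => w.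
  apply: (TTL_up_to_perm (pcons _ _ _) w) => w'; apply: TTL_tens w' => //.
  exact: (TTL_perm (plast _ _) IA).
- move=> G A B i j _; rewrite !map_cat -!cat_cons => IB jA iu il /cseq_wf_classical.
  rewrite /classical_seq map_cat -cat_cons /= classical_isub -csubu_dual => w.
  apply: (TTL_up_to_perm (pswap (classical B :: _) _ _) w) => w'.
  by apply: TTL_botR w'; rewrite ?cFIu_dual ?cFIl_dual ?cFIu_classical ?cFIl_classical.
- move=> G A i j _ IA jA iu il /cseq_wf_classical.
  rewrite /classical_seq /= classical_isub => w.
  set X := map _ G.
  apply: (TTL_up_to_perm _ w) => [|w'].
    apply: (Permutation_trans (pcat X [:: _; _])).
    exact: perm_swap.
  apply: TTL_botR w'; rewrite ?cFIu_classical ?cFIl_classical //.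
  exact: (TTL_perm (plast _ _) IA).
- move=> G A B i j _; rewrite !map_cat -!cat_cons => IB jA iu il /cseq_wf_classical.
  rewrite /classical_seq map_cat -cat_cons /= classical_isub -csubl_dual => w.
  apply: (TTL_botL (G := classical B :: _) (j := j)) w;
    rewrite ?cFIu_dual ?cFIl_dual ?cFIu_classical ?cFIl_classical //.
  by apply: (TTL_perm _ IB); exact: pswap.
move=> G A i j _; rewrite !map_cat => IA jA iu il /cseq_wf_classical.
rewrite /classical_seq /= classical_isub => w.
apply: (TTL_up_to_perm (Permutation_sym (plast _ _)) w) => w'.
apply: TTL_botL w'; rewrite ?cFIu_classical ?cFIl_classical //.
set X := map _ G.
apply: (TTL_perm _ IA); apply: (Permutation_trans _ (pcat [:: _; _] X)).
by apply: perm_skip; apply: Permutation_sym; apply: plast.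
Qed.

(** * Validity of sequents derivable in ITTL *)

Section IntuitionisticInterpretation.
Variable M : model Ind v.
Local Notation D := (dualizing (msys M)).

(** Implication is the one case where the two interpretations differ in form. The disjointness
    conditions of [plolli_ppar] come from separation of the dual of [A] from [B]. *)
Lemma iinterp_classical A : iwf v A -> iinterp M A = cinterp M (classical A).
Proof.
elim: A => // A IA B IB; rewrite -cwf_classical => w.
  have [wA wB _] : [/\ cwf v (classical A), cwf v (classical B) & _] := cwf_tensP w.
  by rewrite /= IA ?IB -?cwf_classical.
have [wA wB AB] : [/\ cwf v (cdual (classical A)), cwf v (classical B)
  & separated (cdual (classical A)) (classical B)] := cwf_parP w.
have [du dl] := separated_FI wA wB AB; rewrite cFIu_dual cFIl_dual in du dl.
rewrite cwf_dual in wA.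
have [[tA uA lA] [tB uB lB]] := (cinterp_type M wA, cinterp_type M wB).
by rewrite /= IA ?IB -?cwf_classical // cinterp_dual // (plolli_ppar tA tB) // ?uA
  ?lA ?uB ?lB // fdisjoint_sym.
Qed.

Lemma ITTL_valid G A : ITTL v G A -> ivalid M G A.
Proof.
move=> dGA ts tsG; have w := ITTL_wf dGA.
have [wall /= /andP[_ pu] /andP[_ pl] _] := w.
move: wall => /= /andP[wA wG].
have dts : duals (M := M) (map (fun B => cdual (classical B)) G) ts.
  elim: tsG wG {w pu pl dGA} => {ts G} [|t B ts G Bt _ IH] /=; first by constructor.
  case/andP=> wB /IH ?; constructor => //; move: wB; rewrite cwf_dual => wB.
  (* The context contains the dual of [B], so [t] has to lie in the bidual of the interpretation of
     [B], which is that interpretation itself. *)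
  have [[_ eB] _ _] := cinterp_type M wB.
  by rewrite cinterp_dual // -eB -iinterp_classical // -cwf_classical.
exists (prods ts); first exact/is_prods_prods/(compat_duals wG pu pl dts).
rewrite iinterp_classical -?cwf_classical //.
have sG : csound M (classical_seq G A) by apply: TTL_sound; apply: TTL_classical.
by apply: (iffLR (csoundP _ w) sG).
Qed.

End IntuitionisticInterpretation.
End Translation.

Theorem theorem7p13 (Ind : choiceType)
    (Ind_infinite : infinite_set (@setT Ind))
    (Lit : Type) (v : Lit -> nat * nat) (M : model Ind v) :
  (forall G : seq (cform Ind Lit), TTL v G -> cvalid M G) /\
  (forall (G : seq (iform Ind Lit)) (A : iform Ind Lit),
     ITTL v G A -> ivalid M G A).
Proof. by split=> [G|G A]; [apply: TTL_valid|apply: ITTL_valid]. Qed.
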